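(* Let $P^{00}$ and $Q^{00}$ be the laws on $\mathscr{U}$ of the bridges from and to the origin of the continuous-time random walks on $\{0,1\}$ with jump rates $\alpha$ and $\beta$ respectively. Then $$d_{W,1}(P^{00},Q^{00})\le\frac92\,|\alpha^2-\beta^2|.$$
   Context: For $\alpha\ge 0$, the random walk on $\{0,1\}$ with jump rate $\alpha$ is the continuous-time Markov chain on $\{0,1\}$, with time horizon $[0,1]$, which at rate $\alpha$ jumps from its current state to the other one. If $P$ is its law on the càdlàg path space $\mathbb{D}([0,1];\{0,1\})$, its bridge from and to the origin is $P(\cdot\mid X_0=0,X_1=0)$. $\mathscr{U}$ is the set of all finite subsets $U\subset(0,1)$ of even cardinality (including $\emptyset$). The càdlàg paths with values in $\{0,1\}$ starting and ending at $0$ are in bijection with $\mathscr{U}$ by sending a path to its set of jump times; $\mathscr{U}$ carries the $\sigma$-algebra transported by this bijection, and bridge laws are identified with their push-forward to $\mathscr{U}$. For $r\ne s$ in $(0,1)$ define $\Psi_{r,s}:\mathscr{U}\to\mathscr{U}$ by $\Psi_{r,s}(U)=U\cup\{r,s\}$ if $\{r,s\}\cap U=\emptyset$, $\Psi_{r,s}(U)=U\setminus\{r,s\}$ if $\{r,s\}\subset U$, and $\Psi_{r,s}(U)=U$ otherwise. $\mathscr{U}$ is given the graph structure in which $U\neq V$ are neighbours iff $U=\Psi_{r,s}V$ for some $r<s$ in $(0,1)$; $d$ is the resulting graph distance. $\mathrm{Lip}_1(\mathscr{U})$ is the set of measurable $f:\mathscr{U}\to\mathbb{R}$ with $|f(U)-f(V)|\le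 d(U,V)$ for all $U,V$, and $d_{W,1}(\mu,\nu)=\sup\{|\int f\,d\mu-\int f\,d\nu|:f\in\mathrm{Lip}_1(\mathscr{U}),\ f\ \mu\text{- and }\nu\text{-integrable}\}$. *)

(* Defs.v *)
From HB Require Import structures.
From mathcomp Require Import all_boot all_order all_algebra finmap.
From mathcomp Require Import all_classical all_reals all_analysis.

Set Implicit Arguments.
Unset Strict Implicit.
Unset Printing Implicit Defensive.
Import Order.TTheory GRing.Theory Num.Theory numFieldNormedType.Exports.
Local Open Scope classical_set_scope.
Local Open Scope ring_scope.

(* A path on [0,1] is encoded by its extension by 0 to the whole line, so that
   equality of encodings is equality of paths on [0,1].  The states 0 and 1 are
   false and true; convergence is for the discrete topology of bool. *)
Record cadlag (R : realType) := Cadlag {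
  cadlag_fun :> R -> bool;
  cadlag_right : forall t, 0 <= t < 1 ->
    cadlag_fun u @[u --> t^'+] --> cadlag_fun t;
  cadlag_left : forall t, 0 < t <= 1 -> cvg (cadlag_fun u @[u --> t^'-]);
  cadlag_out : forall t, ~~ (0 <= t <= 1) -> cadlag_fun t = false
}.

Lemma zero_path_right (R : realType) (t : R) :
  (fun=> false) u @[u --> t^'+] --> false.
Proof. exact: cvg_cst. Qed.

Lemma zero_path_left (R : realType) (t : R) :
  cvg ((fun=> false) u @[u --> t^'-]).
Proof. exact: is_cvg_cst. Qed.

Definition zero_path (R : realType) : cadlag R :=
  @Cadlag R (fun=> false) (fun t _ => @zero_path_right R t)
    (fun t _ => @zero_path_left R t) (fun _ _ => erefl).

HB.instance Definition _ (R : realType) := gen_eqMixin (cadlag R).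
HB.instance Definition _ (R : realType) := gen_choiceMixin (cadlag R).
HB.instance Definition _ (R : realType) :=
  isPointed.Build (cadlag R) (zero_path R).

Definition state_at (R : realType) (t : R) (x : bool) : set (cadlag R) :=
  [set X | X t = x].

Definition coordinates (R : realType) (s : R) : set (set (cadlag R)) :=
  [set A | exists u x, 0 <= u <= s /\ A = state_at u x].

Definition history (R : realType) (s : R) : set (set (cadlag R)) :=
  <<s coordinates s >>.

(* The coordinate sigma-algebra is the Borel sigma-algebra of the Skorokhod
   topology. *)
Definition path_space (R : realType) := g_sigma_algebraType (@coordinates R 1).
HB.instance Definition _ (R : realType) := Measurable.on (path_space R).

Definition generator (R : realType) (a : R) (x y : bool) : R :=
  if x == y then - a else a.

(* p_t = exp(t * generator a), through the (forward) Kolmogorov equation, whose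
   solution is unique. *)
Definition transition_function (R : realType) (a : R)
    (p : R -> bool -> bool -> R) : Prop :=
  (forall x y, p 0 x y = (x == y)%:R) /\
  (forall (t : R) x y, is_derive t (1 : R) (fun u : R => p u x y)
     (\sum_(z : bool) p t x z * generator a z y)).

(* P is the law of a continuous-time Markov chain on {0,1} with jump rate a,
   with an arbitrary initial distribution. *)
Definition random_walk_law (R : realType) (a : R)
    (P : probability (path_space R) R) : Prop :=
  exists2 p, transition_function a p &
  forall (s t : R) (H : set (cadlag R)) (x y : bool),
    0 <= s -> s <= t -> t <= 1 -> history s H ->
    P (H `&` state_at s x `&` state_at t y) =
    (P (H `&` state_at s x) * (p (t - s) x y)%:E)%E.

Definition bridge_paths (R : realType) : set (cadlag R) :=
  state_at 0 false `&` state_at 1 false.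

Lemma measurable_state_at (R : realType) (t : R) (x : bool) :
  0 <= t <= 1 -> measurable (state_at t x : set (path_space R)).
Proof. by move=> t01; apply: sub_sigma_algebra; exists t, x. Qed.

Lemma measurable_bridge_paths (R : realType) :
  measurable (@bridge_paths R : set (path_space R)).
Proof.
by apply: measurableI; apply: measurable_state_at; rewrite lexx ler01.
Qed.

Definition even_pred (R : realType) (U : {fset R}) : bool :=
  all (fun t => 0 < t < 1) (enum_fset U) && ~~ odd #|` U|.

Record evenset (R : realType) := EvenSet {
  evenset_val :> {fset R};
  evenset_valP : even_pred evenset_val
}.

HB.instance Definition _ (R : realType) := [isSub for @evenset_val R].
HB.instance Definition _ (R : realType) := [Choice of evenset R by <:].

Lemma even_pred0 (R : realType) : @even_pred R fset0.
Proof. by rewrite /even_pred cardfs0 andbT; apply/allP => t; rewrite inE. Qed.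

Definition evenset0 (R : realType) : evenset R := EvenSet (even_pred0 R).

HB.instance Definition _ (R : realType) :=
  isPointed.Build (evenset R) (evenset0 R).

Definition jump_times (R : realType) (X : cadlag R) : set R :=
  [set t | 0 < t < 1 /\ ~ {for t, continuous X}].

(* The set of jump times of a path X with X_0 = X_1 = 0 has even cardinality,
   except when X jumps at time 1 exactly.  These exceptional paths, which form a
   measurable set of probability 0, are sent to the empty set; off this set, the
   restriction of jump_set to bridge_paths is a bijection onto evenset. *)
Definition jump_set (R : realType) (X : cadlag R) : evenset R :=
  insubd (evenset0 R) (fset_set (jump_times X)).

(* The sigma-algebra transported from the trace of path_space on bridge_paths. *)
Definition evenset_measurable (R : realType) : set (set (evenset R)) :=
  image_set_system (@bridge_paths R) (@jump_set R)
    (@measurable _ (path_space R)).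
Arguments evenset_measurable : clear implicits.

Section evenset_sigma_algebra.
Variable R : realType.

Let evenset_measurableE (A : set (evenset R)) : evenset_measurable R A =
  @measurable _ (path_space R) (@bridge_paths R `&` @jump_set R @^-1` A).
Proof. by []. Qed.

Let evenset_measurable0 : evenset_measurable R set0.
Proof.
by rewrite evenset_measurableE preimage_set0 setI0; exact: measurable0.
Qed.

Let evenset_measurableC (A : set (evenset R)) :
  evenset_measurable R A -> evenset_measurable R (~` A).
Proof.
rewrite !evenset_measurableE => mA.
have -> : @bridge_paths R `&` @jump_set R @^-1` (~` A) =
    @bridge_paths R `\` (@bridge_paths R `&` @jump_set R @^-1` A).
  by rewrite setDIr setDv set0U setDE preimage_setC.
by apply: (@measurableD _ (path_space R)) => //; exact: measurable_bridge_paths.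
Qed.

Let evenset_measurable_bigcup (F : (set (evenset R))^nat) :
  (forall i, evenset_measurable R (F i)) ->
  evenset_measurable R (\bigcup_i F i).
Proof.
move=> mF; rewrite evenset_measurableE preimage_bigcup setI_bigcupr.
by apply: (@bigcup_measurable _ (path_space R)) => i _; exact: mF.
Qed.

HB.instance Definition _ := isMeasurable.Build default_measure_display
  (evenset R) evenset_measurable0 evenset_measurableC evenset_measurable_bigcup.

End evenset_sigma_algebra.

Section bridge_law.
Variables (R : realType) (P : probability (path_space R) R).

Definition bridge_law (A : set (evenset R)) : \bar R :=
  (P (bridge_paths (R := R) `&` @jump_set R @^-1` A) *
   ((fine (P (bridge_paths (R := R))))^-1)%:E)%E.

Let bridge_law0 : bridge_law set0 = 0%E.
Proof. by rewrite /bridge_law preimage_set0 setI0 measure0 mul0e. Qed.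

Let bridge_law_ge0 (A : set (evenset R)) : (0 <= bridge_law A)%E.
Proof. by rewrite /bridge_law mule_ge0// lee_fin invr_ge0 fine_ge0. Qed.

Let bridge_law_sigma_additive : semi_sigma_additive bridge_law.
Proof.
move=> F mF tF mUF; rewrite /bridge_law preimage_bigcup setI_bigcupr.
rewrite [X in X @ _ --> _](_ : _ = fun n =>
  ((\sum_(0 <= i < n) P (bridge_paths (R := R) `&` @jump_set R @^-1` F i)) *
   ((fine (P (bridge_paths (R := R))))^-1)%:E)%E); last first.
  by apply/funext => n; rewrite ge0_sume_distrl.
apply: cvgeZr => //; apply: measure_semi_sigma_additive => //.
- apply/trivIsetP => i j _ _ ij.
  rewrite setIACA setIid -preimage_setI.
  by move/trivIsetP : tF => ->//; rewrite preimage_set0 setI0.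
- by apply: (@bigcup_measurable _ (path_space R)) => i _; exact: mF.
Qed.

HB.instance Definition _ := isMeasure.Build _ _ _ bridge_law
  bridge_law0 bridge_law_ge0 bridge_law_sigma_additive.

End bridge_law.

Definition toggle (R : realType) (r s : R) (U : {fset R}) : {fset R} :=
  (if [fset r; s] `&` U == fset0 then U `|` [fset r; s]
   else if [fset r; s] `<=` U then U `\` [fset r; s]
   else U)%fset.

Lemma toggle_even (R : realType) (r s : R) (U : evenset R) :
  0 < r < 1 -> 0 < s < 1 -> r != s -> even_pred (toggle r s U).
Proof.
move=> r01 s01 rs; have /andP[/allP U01 Ueven] := evenset_valP U.
rewrite /toggle; case: ifPn => [/eqP dU|_].
  apply/andP; split.
    by apply/allP => t; rewrite !inE => /orP[/U01//|/orP[]/eqP ->].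
  by rewrite cardfsU fsetIC dU cardfs0 subn0 cardfs2 rs oddD/= addbF.
case: ifPn => [sU|_]; last exact: evenset_valP.
apply/andP; split; first by apply/allP => t; rewrite !inE => /andP[_ /U01].
rewrite cardfsD; have /fsetIidPr -> := sU.
have := fsubset_leq_card sU; rewrite cardfs2 rs => le2.
by rewrite oddB//= addbF.
Qed.

(* The default value of insubd is only reached when r = s or when r or s is not
   in ]0,1[, see PsiE. *)
Definition Psi (R : realType) (r s : R) (U : evenset R) : evenset R :=
  insubd U (toggle r s U).

Lemma PsiE (R : realType) (r s : R) (U : evenset R) :
  0 < r < 1 -> 0 < s < 1 -> r != s -> Psi r s U = toggle r s U :> {fset R}.
Proof.
by move=> r01 s01 rs; rewrite /Psi (insubdK _ (toggle_even U r01 s01 rs)).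
Qed.

Definition neighbours (R : realType) (U V : evenset R) : Prop :=
  U <> V /\ exists r s : R, [/\ 0 < r, r < s, s < 1 & U = Psi r s V].

Definition graph_dist (R : realType) (U V : evenset R) : \bar R :=
  ereal_inf [set (size w)%:R%:E | w in
    [set w : seq (evenset R) |
      path (fun A B => `[< neighbours A B >]) U w /\ last U w = V]].

Definition Lip1 (R : realType) : set (evenset R -> R) :=
  [set f : evenset R -> R | measurable_fun [set: evenset R] f /\
    forall U V, ((`|f U - f V|)%:E <= graph_dist U V)%E].
Arguments Lip1 : clear implicits.

Definition dW1 (R : realType) (mu nu : {measure set (evenset R) -> \bar R}) :
    \bar R :=
  ereal_sup [set (`| \int[mu]_U (f U)%:E - \int[nu]_U (f U)%:E |)%E | f in
    [set f : evenset R -> R | [/\ Lip1 R f,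
       mu.-integrable [set: evenset R] (EFin \o f) &
       nu.-integrable [set: evenset R] (EFin \o f)]]].

(* Main.v *)
Require Import Defs.
From HB Require Import structures.
From mathcomp Require Import all_boot all_order all_algebra finmap.
From mathcomp Require Import all_classical all_reals all_analysis.
From mathcomp Require Import measurable_realfun ring lra.
Import Order.TTheory GRing.Theory Num.Theory numFieldNormedType.Exports.
Local Open Scope classical_set_scope.
Local Open Scope ring_scope.

Set Implicit Arguments.
Unset Strict Implicit.
Unset Printing Implicit Defensive.

(** Given that it has [2k] jumps, the bridge of either walk is the random
    even set of [2k] independent uniform times of ]0,1[, whatever the jump rate;
    and the number of jumps equals [k] with probability proportional to
    [a ^ k / k!] on even [k].  So both bridges are mixtures of the same laws,
    and only the weights depend on the rate.

    The mixture is built on path space: [flip r] adds a jump at time [r],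
    [jumps_law k] is the law of the path obtained from the zero path by [k]
    uniform independent flips, and [started_mixture] identifies the law of the
    walk started at 0 with the Poisson mixture of the [jumps_law k].  To prove
    it, the expectations of the characters (-1)^(X_t1 + ... + X_tn) are compared:
    a flip multiplies such an expectation by a constant ([walsh_jump_law]), so
    that the mixture sums to an exponential, and the Markov property gives the
    same exponential ([walsh_started]).  Characters determine the probabilities
    of cylinders ([walsh_cylinder_cons]), hence the law.

    Let [f] be 1-Lipschitz and let [F k] be its mean under [k] jumps, where a
    path with an odd number of jumps is first given one more jump, at 1/2
    ([pin]).  One more flip moves the resulting even set by at most two steps
    of the graph ([lipschitz_pin]), so [|F (k + 1) - F k| <= 2]
    ([pin_law_step]).  The integrals of [f] under the two bridges are thus the
    means of one 2-Lipschitz sequence for two weights [a ^ k / k!] on even [k].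
    These weights increase stochastically with the rate, so by Chebyshev's
    inequality the difference is at most twice the difference of the mean
    numbers of jumps [a tanh a]; the latter is [a ^ 2] times the mean of
    [1 / (k + 1)], which is at most 1 and decreases with [a], so it varies by at
    most [|a ^ 2 - b ^ 2|] ([cosh_sum_lipschitz]).  This gives the constant 2,
    below 9/2. *)

(** * Sums weighted by the coefficients of cosh *)

Section comparison.
Context {R : realType}.
Implicit Types (a g : nat -> R) (x y : R).

Definition weighted_sum a x g (n : nat) : R := \sum_(k < n) a k * x ^+ k * g k.

Lemma weighted_sumD a x g h n : weighted_sum a x (fun k => g k + h k) n =
  weighted_sum a x g n + weighted_sum a x h n.
Proof. by rewrite -big_split; apply: eq_bigr => k _; rewrite mulrDr. Qed.

Lemma weighted_sumZ a x c g n :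
  weighted_sum a x (fun k => c * g k) n = c * weighted_sum a x g n.
Proof. by rewrite big_distrr; apply: eq_bigr => k _; rewrite mulrCA. Qed.

(** Chebyshev's inequality in cross-multiplied form: raising [x] shifts the
    weights [a k * x ^+ k] to larger [k], so it raises the mean of a
    nondecreasing sequence.  Twice the difference of the two sides is the double
    sum of the products
    [a j * a k * (x ^+ j * y ^+ k - y ^+ j * x ^+ k) * (g j - g k)], whose two
    last factors have the same sign. *)
Lemma chebyshev_weighted_sum a x y g n : 0 <= y -> y <= x ->
  (forall k, 0 <= a k) ->
  (forall j k, (j <= k)%N -> (k < n)%N -> g j <= g k) ->
  weighted_sum a y g n * weighted_sum a x (fun=> 1) n <=
  weighted_sum a x g n * weighted_sum a y (fun=> 1) n.
Proof.
move=> y0 yx a0 gmono; have x0 := le_trans y0 yx.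
have wE u v : weighted_sum a u g n * weighted_sum a v (fun=> 1) n =
    \sum_(j < n) \sum_(k < n) a j * a k * (u ^+ j * v ^+ k) * g j.
  rewrite big_distrl; apply: eq_bigr => j _.
  by rewrite big_distrr; apply: eq_bigr => k _ /=; ring.
have wE' u v : weighted_sum a u g n * weighted_sum a v (fun=> 1) n =
    \sum_(j < n) \sum_(k < n) a j * a k * (u ^+ k * v ^+ j) * g k.
  rewrite wE exchange_big; apply: eq_bigr => j _.
  by apply: eq_bigr => k _ /=; ring.
rewrite -subr_ge0 -(pmulrn_lge0 _ (ltn0Sn 1)) mulr2n.
rewrite {1}(wE x y) (wE' x y) {1}(wE y x) (wE' y x) -!sumrB -big_split.
apply: sumr_ge0 => j _ /=; rewrite -!sumrB -big_split; apply: sumr_ge0 => k _ /=.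
have -> : a j * a k * (x ^+ j * y ^+ k) * g j -
    a j * a k * (y ^+ j * x ^+ k) * g j +
    (a j * a k * (x ^+ k * y ^+ j) * g k -
     a j * a k * (y ^+ k * x ^+ j) * g k) =
  a j * a k * ((x ^+ j * y ^+ k - y ^+ j * x ^+ k) * (g j - g k)) by ring.
have pow_mono (i l : nat) : (i <= l)%N -> x ^+ i * y ^+ l <= y ^+ i * x ^+ l.
  move=> il.
  have split_pow u v : u ^+ i * v ^+ l = (u ^+ i * v ^+ i) * v ^+ (l - i).
    by rewrite -mulrA -exprD subnKC.
  rewrite !split_pow [y ^+ i * _]mulrC ler_wpM2l ?lerXn2r ?nnegrE//.
  by rewrite mulr_ge0 ?exprn_ge0.
apply: mulr_ge0; first exact: mulr_ge0.
case/orP: (leq_total j k) => jk.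
  have := gmono _ _ jk (ltn_ord k); have := pow_mono _ _ jk; nra.
have := gmono _ _ jk (ltn_ord j); have := pow_mono _ _ jk; nra.
Qed.


Lemma ler_weighted_sum a x g h n : 0 <= x -> (forall k, 0 <= a k) ->
  (forall k, (k < n)%N -> g k <= h k) ->
  weighted_sum a x g n <= weighted_sum a x h n.
Proof.
move=> x0 a0 gh; apply: ler_sum => k _; apply: ler_wpM2l; last exact: gh.
by rewrite mulr_ge0// exprn_ge0.
Qed.

Definition cosh_coeff (k : nat) : R := if odd k then 0 else (k`!%:R)^-1.

Lemma cosh_coeff_ge0 k : 0 <= cosh_coeff k.
Proof. by rewrite /cosh_coeff; case: ifP => // _; rewrite invr_ge0. Qed.

(** The cut-off at [n] makes [cosh_sum_mean] an identity between truncated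
    sums: the last two indices have no counterpart after the shift by 2. *)
Definition inv_succ_below n k : R := if (k.+2 < n)%N then (k.+1%:R)^-1 else 0.

Lemma inv_succ_below_noninc n j k : (j <= k)%N ->
  inv_succ_below n k <= inv_succ_below n j.
Proof.
move=> jk; rewrite /inv_succ_below; case: ifPn => kn.
  rewrite (leq_ltn_trans _ kn); last by rewrite !ltnS.
  by rewrite lef_pV2 ?posrE ?ltr0n// ler_nat ltnS.
by case: ifPn => // _; rewrite invr_ge0.
Qed.

(** Truncated form of the formula [x * tanh x] for the mean of an even number
    with weights [x ^+ k / k`!]; it follows from
    [(k + 2) / (k + 2)! = 1 / ((k + 1) k!)]. *)
Lemma cosh_sum_mean x n : weighted_sum cosh_coeff x (fun k => k%:R) n =
  x ^+ 2 * weighted_sum cosh_coeff x (inv_succ_below n) n.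
Proof.
case: n => [|[|n]].
- by rewrite /weighted_sum !big_ord0 mulr0.
- by rewrite /weighted_sum !big_ord1 /= /inv_succ_below !mulr0.
rewrite /weighted_sum 2!big_ord_recl /= mulr0 add0r.
rewrite {1}/cosh_coeff /= !mul0r add0r.
rewrite [in RHS]big_ord_recr /= [in RHS]big_ord_recr /= /inv_succ_below.
rewrite !ltnS ltnn ltnNge leqnSn /= !mulr0 !addr0 big_distrr /=.
apply: eq_bigr => k _; rewrite /= !ltnS ltn_ord /bump /= !add1n.
rewrite /cosh_coeff /= negbK; case: ifP => _; first by rewrite !mul0r mulr0.
rewrite !exprS !factS !natrM; field.
by rewrite nat1r -natrD !pnatr_eq0 (gtn_eqF (fact_gt0 k)).
Qed.

(** A bound on the difference of the means of [F] for the weights at [x] and at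
    [y], stated without division.  Chebyshev's inequality for the nondecreasing
    sequences [C k + F k] and [C k - F k] reduces it to [F k = C k].  By
    [cosh_sum_mean] the mean of [k] is [x ^+ 2] times a mean of
    [inv_succ_below n], which lies in [0, 1] and, by Chebyshev's inequality
    again, decreases in [x]; the growth of the product comes from [x ^+ 2]
    alone. *)
Lemma cosh_sum_lipschitz x y (C : R) (F : nat -> R) n : 0 <= x -> 0 <= y ->
  (forall k, `|F k.+1 - F k| <= C) ->
  `|weighted_sum cosh_coeff x F n * weighted_sum cosh_coeff y (fun=> 1) n -
    weighted_sum cosh_coeff y F n * weighted_sum cosh_coeff x (fun=> 1) n| <=
  C * `|x ^+ 2 - y ^+ 2| * (weighted_sum cosh_coeff x (fun=> 1) n *
                            weighted_sum cosh_coeff y (fun=> 1) n).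
Proof.
move=> + + Flip; wlog yx : x y / y <= x => [wh|] x0 y0.
  have [/wh|/ltW xy] := leP y x; first by apply.
  rewrite distrC (distrC (x ^+ 2)).
  by rewrite [X in _ <= _ * X]mulrC; exact: wh.
have a0 := cosh_coeff_ge0.
have mono (G : nat -> R) : (forall k, `|G k.+1 - G k| <= C) ->
    forall j k, (j <= k)%N -> C * j%:R + G j <= C * k%:R + G k.
  move=> Glip j k /subnK <-; elim: (k - j)%N => // i IH.
  apply: le_trans IH _; rewrite addSn -[(i + j).+1%:R]natr1.
  by have := Glip (i + j)%N; rewrite ler_norml; lra.
have up := @chebyshev_weighted_sum cosh_coeff x y _ n y0 yx a0
  (fun j k jk _ => mono F Flip j k jk).
have NFlip k : `|- F k.+1 - - F k| <= C by rewrite -opprD normrN.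
have down := @chebyshev_weighted_sum cosh_coeff x y _ n y0 yx a0
  (fun j k jk _ => mono (fun k => - F k) NFlip j k jk).
have rhoN j k (jk : (j <= k)%N) (_ : (k < n)%N) :
    -1 * inv_succ_below n j <= -1 * inv_succ_below n k.
  by rewrite !mulN1r lerN2 inv_succ_below_noninc.
have rho := @chebyshev_weighted_sum cosh_coeff x y _ n y0 yx a0 rhoN.
have opp u : weighted_sum cosh_coeff u (fun k => - F k) n =
    - weighted_sum cosh_coeff u F n.
  rewrite -mulN1r -weighted_sumZ.
  by apply: eq_bigr => k _; rewrite mulN1r.
rewrite !weighted_sumD !weighted_sumZ ?opp !cosh_sum_mean in up down rho.
have rho1 : weighted_sum cosh_coeff y (inv_succ_below n) n <=
    weighted_sum cosh_coeff y (fun=> 1) n.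
  apply: ler_weighted_sum => // k _; rewrite /inv_succ_below; case: ifP => // _.
  by rewrite invf_le1 ?ltr0n// ler1n.
have Cx0 : 0 <= weighted_sum cosh_coeff x (fun=> 1) n.
  by apply: sumr_ge0 => k _; rewrite mulr1 mulr_ge0// exprn_ge0.
have Cy0 : 0 <= weighted_sum cosh_coeff y (fun=> 1) n.
  by apply: sumr_ge0 => k _; rewrite mulr1 mulr_ge0// exprn_ge0.
have xy2 : y ^+ 2 <= x ^+ 2 by rewrite lerXn2r ?nnegrE.
rewrite (ger0_norm (_ : 0 <= x ^+ 2 - y ^+ 2)) ?subr_ge0//.
move: rho rho1 up down Cx0 Cy0.
set Wx := weighted_sum _ x (inv_succ_below n) n.
set Wy := weighted_sum _ y (inv_succ_below n) n.
set Cx := weighted_sum _ x _ n; set Cy := weighted_sum _ y _ n.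
set A := weighted_sum _ x _ n; set B := weighted_sum _ y _ n.
move=> rho rho1 up down Cx0 Cy0.
have mean : x ^+ 2 * Wx * Cy - y ^+ 2 * Wy * Cx <= (x ^+ 2 - y ^+ 2) * (Cx * Cy).
  have x2 : 0 <= x ^+ 2 by exact: sqr_ge0.
  have h1 : x ^+ 2 * (Wx * Cy) <= x ^+ 2 * (Wy * Cx) by apply: ler_wpM2l => //; lra.
  have h2 : (x ^+ 2 - y ^+ 2) * (Wy * Cx) <= (x ^+ 2 - y ^+ 2) * (Cx * Cy).
    by rewrite ler_wpM2l ?subr_ge0// mulrC ler_wpM2l.
  lra.
have C0 : 0 <= C by exact: le_trans (Flip 0%N).
have := ler_wpM2l C0 mean; rewrite ler_norml; lra.
Qed.

End comparison.

(** * Adding a jump to a path *)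

Section flips.
Context {R : realType}.
Implicit Types (r s t : R) (X : cadlag R) (U V : evenset R).

Lemma bool_cvgP {F : set_system R} {FF : Filter F} (f : R -> bool) (b : bool) :
  f u @[u --> F] --> b <-> \forall u \near F, f u = b.
Proof. exact: discrete_cvg. Qed.

(** With [clip] every real number designates a time of ]0,1[, so that what
    follows holds for every flip instead of almost every one. *)
Definition clip r : R := if 0 < r < 1 then r else 2^-1.

Lemma clip_itv r : 0 < clip r < 1.
Proof.
by rewrite /clip; case: ifP => // _; rewrite invr_gt0 invf_lt1 ?ltr1n ltr0n.
Qed.

Lemma clip_id r : 0 < r < 1 -> clip r = r.
Proof. by rewrite /clip => ->. Qed.

Definition jump_after r t : bool := (clip r <= t) && (t <= 1).

Lemma jump_after_right r t : 0 <= t < 1 ->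
  \forall u \near t^'+, jump_after r u = jump_after r t.
Proof.
move=> /andP[t0 t1]; rewrite /jump_after (ltW t1) andbT; have [rt|tr] := leP.
  near=> u; have tu : t < u by near: u; exact: nbhs_right_gt.
  rewrite (le_trans rt (ltW tu)) /=.
  by near: u; apply: nbhs_right_le.
near=> u; suff ur : u < clip r by rewrite leNgt ur.
by near: u; apply: nbhs_right_lt.
Unshelve. all: by end_near. Qed.

Lemma jump_after_left r t : 0 < t <= 1 ->
  \forall u \near t^'-, jump_after r u = (clip r < t).
Proof.
move=> /andP[t0 t1]; rewrite /jump_after; have [rt|tr] := ltP.
  near=> u; have ut : u < t by near: u; exact: nbhs_left_lt.
  by rewrite (le_trans (ltW ut) t1) andbT; near: u; apply: nbhs_left_ge.
near=> u; have ut : u < t by near: u; exact: nbhs_left_lt.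
by rewrite leNgt (lt_le_trans ut tr).
Unshelve. all: by end_near. Qed.

Lemma cadlag_leftP X t : 0 < t <= 1 -> exists b, \forall u \near t^'-, X u = b.
Proof.
by move=> t01; have /cvg_ex[b /= /bool_cvgP Xb] := @cadlag_left _ X _ t01; exists b.
Qed.

Lemma flip_right r X t : 0 <= t < 1 ->
  (fun u => X u (+) jump_after r u) u @[u --> t^'+] --> X t (+) jump_after r t.
Proof.
move=> t01; apply/bool_cvgP; have /bool_cvgP Xt := @cadlag_right _ X _ t01.
near=> u; congr addb; near: u; [exact: Xt|exact: jump_after_right].
Unshelve. all: by end_near. Qed.

Lemma flip_left r X t : 0 < t <= 1 ->
  cvg ((fun u => X u (+) jump_after r u) u @[u --> t^'-]).
Proof.
move=> t01; have [b Xb] := cadlag_leftP X t01.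
apply/cvg_ex; exists (b (+) (clip r < t)); apply/bool_cvgP.
near=> u; congr addb; near: u; [exact: Xb|exact: jump_after_left].
Unshelve. all: by end_near. Qed.

Lemma flip_out r X t : ~~ (0 <= t <= 1) -> X t (+) jump_after r t = false.
Proof.
move=> t01; rewrite (cadlag_out _ t01) /jump_after /=.
have /andP[r0 _] := clip_itv r.
by apply: contraNF t01 => /andP[rt ->]; rewrite (le_trans (ltW r0) rt).
Qed.

(** In terms of jump sets, the symmetric difference with [{clip r}]; a flip
    changes the state at time 1, so it never maps a bridge to a bridge. *)
Definition flip r X : cadlag R :=
  Cadlag (@flip_right r X) (@flip_left r X) (@flip_out r X).

Lemma cadlag_eq X X' : X =1 X' -> X = X'.
Proof.
case: X X' => [X rX lX oX] [X' rX' lX' oX'] /= /funext XX'; subst X'.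
by congr Cadlag; exact: Prop_irrelevance.
Qed.

Lemma flipK r : involutive (flip r).
Proof. by move=> X; apply: cadlag_eq => t /=; rewrite addbK. Qed.

Lemma flip0 r X : flip r X 0 = X 0.
Proof.
by rewrite /= /jump_after leNgt; case/andP: (clip_itv r) => -> _; rewrite addbF.
Qed.

Lemma flip1 r X : flip r X 1 = ~~ X 1.
Proof.
rewrite /= /jump_after lexx andbT ltW ?addbT//.
by case/andP: (clip_itv r).
Qed.

(** Right continuity leaves the left limit as the only obstacle to continuity. *)
Lemma jump_timesP X t b : 0 < t < 1 -> (\forall u \near t^'-, X u = b) ->
  jump_times X t <-> b != X t.
Proof.
move=> t01 Xb; have [t0 t1] := andP t01.
have t01' : 0 <= t < 1 by rewrite ltW.
have contE : {for t, continuous X} <-> b = X t.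
  split=> [/left_right_continuousP[/bool_cvgP Xl _]|bX].
    near t^'- => u; transitivity (X u); last by near: u.
    by apply/esym; near: u.
  apply/left_right_continuousP; split; last exact: cadlag_right.
  by apply/bool_cvgP; rewrite -bX.
rewrite /jump_times /= contE; split=> [[_ /eqP]//|/eqP bX]; split => //.
Unshelve. all: by end_near. Qed.

Lemma jump_times_flip r X t : 0 < t < 1 ->
  jump_times (flip r X) t <-> ~ (jump_times X t <-> clip r = t).
Proof.
move=> t01; have [t0 t1] := andP t01.
have t01' : 0 < t <= 1 by rewrite t0 ltW.
have [b Xb] := cadlag_leftP X t01'.
have fXb : \forall u \near t^'-, flip r X u = b (+) (clip r < t).
  by near=> u; congr addb; near: u; [exact: Xb|exact: jump_after_left].
rewrite (jump_timesP t01 Xb) (jump_timesP t01 fXb) /= /jump_after (ltW t1) andbT.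
rewrite [clip r <= t]le_eqVlt; have [rt|rt] := eqVneq (clip r) t.
  rewrite rt ltxx /=; split.
    by case: b (X t) {Xb fXb} => [] [] //= _ [h1 h2]; have := h2 erefl.
  by case: b (X t) {Xb fXb} => [] [] //= h; case: h; split.
rewrite (can_eq (@addbK _)); split=> [bX h|h].
  by move: rt => /eqP; apply; apply/h.
by apply/negP => /eqP bX; apply: h; split=> [|/eqP]; rewrite ?bX ?eqxx// (negbTE rt).
Unshelve. all: by end_near. Qed.

End flips.

(** * Jump sets and the graph distance *)

Section jump_sets.
Context {R : realType}.
Implicit Types (r s t : R) (X : cadlag R) (U V : evenset R).

Lemma in_evenset_itv U t : t \in evenset_val U -> 0 < t < 1.
Proof. by have /andP[/allP U01 _] := evenset_valP U; exact: U01. Qed.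

(** The last hypothesis excludes the case where [Psi r s] is the identity. *)
Lemma in_Psi r s U t : 0 < r < 1 -> 0 < s < 1 -> r != s ->
  (r \in evenset_val U) = (s \in evenset_val U) ->
  (t \in evenset_val (Psi r s U)) = (t \in evenset_val U) (+) (t == r) (+) (t == s).
Proof.
move=> r01 s01 rs rsU; rewrite PsiE// /toggle.
have -> : ([fset r; s] `&` evenset_val U == fset0)%fset = (r \notin evenset_val U).
  apply/idP/idP => [/eqP/fsetP/(_ r)|rU].
    by rewrite !inE eqxx /= => ->.
  apply/eqP/fsetP => u; rewrite !inE; apply/negbTE; apply/negP.
  by move=> /andP[/orP[]/eqP->]; rewrite -?rsU (negbTE rU).
have -> : ([fset r; s] `<=` evenset_val U)%fset = (r \in evenset_val U).
  by rewrite fsubUset !fsub1set -rsU andbb.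
have ts (u : R) : u == r -> u == s = false.
  by move=> /eqP ->; apply/negbTE.
case: ifPn => rU /=; rewrite ?negbK in rU; rewrite ?rU !inE;
  have [tr|tr] := eqVneq t r; have [ts'|ts'] := eqVneq t s;
  rewrite ?tr ?ts' ?(negbTE rU) -?rsU ?rU ?(negbTE rU) /= ?addbF ?addbT ?orbF
    ?andbT//.
- by rewrite -tr -ts' eqxx in rs.
- by rewrite -tr -ts' eqxx in rs.
Qed.

Definition graph_lipschitz (f : evenset R -> R) :=
  forall U V, ((`|f U - f V|)%:E <= graph_dist U V)%E.

Lemma lipschitz_Psi f r s U : graph_lipschitz f ->
  0 < r < 1 -> 0 < s < 1 -> r != s -> `|f (Psi r s U) - f U| <= 1.
Proof.
move=> f_lip; wlog rs : r s / r < s => [wh|] r01 s01 neq_rs.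
  case: (ltgtP r s) => [rs|sr|/eqP]; first exact: wh.
  - have -> : Psi r s U = Psi s r U by rewrite /Psi /toggle fsetUC.
    by apply: wh => //; rewrite eq_sym.
  - by rewrite (negbTE neq_rs).
have [->|neqU] := pselect (Psi r s U = U); first by rewrite subrr normr0.
rewrite -lee_fin; apply: le_trans (f_lip _ _) _.
apply: ereal_inf_lbound; exists [:: U] => //=; split => //; rewrite andbT.
apply/asboolP; split => //; exists r, s.
by case/andP: r01 => ? _; case/andP: s01.
Qed.

(** When exactly one of [r] and [s] lies in [U], the sets [U] and [V] are not
    neighbours, but as [#|U|] is even, [U] has a point [q] besides the one to be
    removed: removing that pair and then adding [q] back together with the new
    point joins [U] to [V] in two steps. *)
Lemma lipschitz_symdiff f r s U V : graph_lipschitz f ->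
  0 < r < 1 -> 0 < s < 1 -> r != s ->
  (forall t, (t \in evenset_val V) =
    (t \in evenset_val U) (+) (t == r) (+) (t == s)) ->
  `|f V - f U| <= 2.
Proof.
move=> f_lip; have [rsU|] := eqVneq (r \in evenset_val U) (s \in evenset_val U).
  move=> r01 s01 rs VE; have -> : V = Psi r s U.
    by apply/val_inj/fsetP => t; rewrite VE in_Psi.
  by rewrite (le_trans (lipschitz_Psi _ _ _ _ _))// ler1n.
wlog rU : r s / (r \in evenset_val U) => [wh|].
  have [rU|rU] := boolP (r \in evenset_val U).
    by have := wh r s rU; rewrite rU; apply.
  have [sU _ r01 s01 rs VE|sU] := boolP (s \in evenset_val U); last by [].
  apply: (wh s r) => // [||t]; last by rewrite VE addbAC.
    by rewrite sU (negbTE rU).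
  by rewrite eq_sym.
rewrite rU; case sU : (s \in evenset_val U) => // _ r01 s01 rs VE.
have [q qU qr] : exists2 q, q \in evenset_val U & q != r.
  have /andP[_] := evenset_valP U; rewrite (cardfsD1 r) rU /= negbK.
  have [->|[q]] := fset_0Vmem (evenset_val U `\ r)%fset.
    by rewrite cardfs0.
  by rewrite !inE => /andP[? ?] _; exists q.
have q01 := in_evenset_itv qU.
have qs : q != s by apply/eqP => qs; rewrite qs sU in qU.
pose W := Psi r q U.
have WE t : (t \in evenset_val W) =
    (t \in evenset_val U) (+) (t == r) (+) (t == q).
  by rewrite in_Psi// ?rU ?qU// eq_sym.
have -> : V = Psi s q W.
  apply/val_inj/fsetP => t; rewrite in_Psi//; last 2 first.
  - by rewrite eq_sym.
  - rewrite !WE sU qU eqxx (negbTE qr) (eq_sym s q) (negbTE qs).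
    by rewrite (eq_sym s r) (negbTE rs).
  by rewrite WE VE -!addbA; congr (_ (+) (_ (+) _));
    rewrite addbC -addbA addbb addbF.
rewrite -(subrKA (f W)) (le_trans (ler_normD _ _))// [leRHS](_ : _ = 1 + 1)//.
by rewrite lerD// lipschitz_Psi// eq_sym.
Qed.

Lemma finite_jump_times_flip r X :
  finite_set (jump_times X) -> finite_set (jump_times (flip r X)).
Proof.
move=> Xfin; apply: (@sub_finite_set _ _ (jump_times X `|` [set clip r]));
  last first.
  by rewrite finite_setU.
move=> t Jt; have t01 : 0 < t < 1 by case: Jt.
move/(jump_times_flip r X t01) : Jt => h /=.
have [|nJ] := pselect (jump_times X t); first by left.
have [<-|nr] := pselect (clip r = t); first by right.
by case: h; split.
Qed.

Lemma in_fset_jump_times_flip r X t : finite_set (jump_times X) ->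
  (t \in fset_set (jump_times (flip r X))) =
  (t \in fset_set (jump_times X)) (+) (t == clip r).
Proof.
move=> Xfin; rewrite !in_fset_set//; last exact: finite_jump_times_flip.
have [t01|nt01] := boolP (0 < t < 1); last first.
  have out Y : (t \in jump_times Y) = false.
    by apply/negbTE; rewrite notin_setE => -[Yt _]; rewrite Yt in nt01.
  rewrite !out; apply/esym/eqP => tr; move: nt01.
  by rewrite tr clip_itv.
have : t \in jump_times (flip r X) <-> ~ (t \in jump_times X <-> t == clip r).
  have tE : t == clip r <-> clip r = t by split=> [/eqP->//|->].
  by rewrite !inE; have := jump_times_flip r X t01; tauto.
by case: (_ == _) (_ \in _) (_ \in _) => [] [] [] //= h; exfalso; intuition.
Qed.

Lemma odd_card_toggle (c : R) (S S' : {fset R}) :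
  (forall t, (t \in S') = (t \in S) (+) (t == c)) -> odd #|` S'| = ~~ odd #|` S|.
Proof.
move=> SS'; have [cS|cS] := boolP (c \in S).
  have -> : S' = (S `\ c)%fset.
    apply/fsetP => t; rewrite SS' !inE.
    by have [->|_] := eqVneq t c; rewrite ?cS ?addbF.
  by rewrite [in RHS](cardfsD1 c) cS /= negbK.
have -> : S' = (c |` S)%fset.
  apply/fsetP => t; rewrite SS' !inE.
  by have [->|_] := eqVneq t c; rewrite ?(negbTE cS) ?addbF.
by rewrite cardfsU1 cS.
Qed.

Lemma fset_set_infinite (A : set R) : ~ finite_set A -> fset_set A = fset0.
Proof. by move=> Ainf; rewrite /fset_set; case: pselect. Qed.

Lemma jump_setE X : ~~ odd #|` fset_set (jump_times X)| ->
  evenset_val (jump_set X) = fset_set (jump_times X).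
Proof.
move=> even; rewrite /jump_set insubdK// /even_pred unfold_in even andbT.
apply/allP => t; have [fin|inf] := pselect (finite_set (jump_times X)).
  by rewrite in_fset_set// inE => -[].
by rewrite fset_set_infinite.
Qed.

Lemma jump_set_odd X : odd #|` fset_set (jump_times X)| ->
  jump_set X = evenset0 R.
Proof.
by move=> odd; rewrite /jump_set /insubd insubF// /even_pred odd andbF.
Qed.

(** Two flips preserve the finiteness and the parity of the set of jumps, so
    when [jump_set] takes its default value at one of the two paths, it also
    does at the other; otherwise [lipschitz_symdiff] applies. *)
Lemma lipschitz_jump_set f r s X : graph_lipschitz f ->
  `|f (jump_set (flip r (flip s X))) - f (jump_set X)| <= 2.
Proof.
move=> f_lip; have [Xfin|Xinf] := pselect (finite_set (jump_times X)); last first.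
  rewrite (_ : jump_set _ = jump_set X) ?subrr ?normr0//.
  rewrite /jump_set !fset_set_infinite// => fin; apply: Xinf.
  rewrite -(flipK s X) -[flip s X](flipK r).
  exact/finite_jump_times_flip/finite_jump_times_flip.
have sXfin := finite_jump_times_flip s Xfin.
pose S (Y : cadlag R) := fset_set (jump_times Y).
have SE t : (t \in S (flip r (flip s X))) =
    (t \in S X) (+) (t == clip s) (+) (t == clip r).
  by rewrite /S !in_fset_jump_times_flip.
have oddE : odd #|` S (flip r (flip s X))| = odd #|` S X|.
  rewrite (@odd_card_toggle (clip r) (S (flip s X))) => [|t]; last first.
    by rewrite /S in_fset_jump_times_flip.
  rewrite (@odd_card_toggle (clip s) (S X)) ?negbK// => t.
  by rewrite /S in_fset_jump_times_flip.
have [Xodd|Xeven] := boolP (odd #|` S X|).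
  by rewrite !jump_set_odd -?/(S _) ?oddE// subrr normr0.
have [rs|rs] := eqVneq (clip s) (clip r).
  rewrite (_ : jump_set _ = jump_set X) ?subrr ?normr0//.
  apply/val_inj; rewrite /= !jump_setE -?/(S _) ?oddE//.
  by apply/fsetP => t; rewrite SE rs addbK.
apply: (lipschitz_symdiff f_lip (clip_itv s) (clip_itv r) rs) => t.
by rewrite !jump_setE -?/(S _) ?oddE.
Qed.

End jump_sets.

(** * Random flips, and the even set carried by a path *)

Section uniform.
Context {R : realType}.

Definition unit_law : set (measurableTypeR R) -> \bar R :=
  mrestr lebesgue_measure (measurable_itv `]0 : R, 1[).

HB.instance Definition _ := Measure.on unit_law.

Let unit_law_setT : unit_law setT = 1%E.
Proof.
rewrite /unit_law /= /mrestr setTI lebesgue_measure_itv/= lte01.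
by rewrite sube0.
Qed.

HB.instance Definition _ :=
  Measure_isProbability.Build _ _ _ unit_law unit_law_setT.

End uniform.

Section measurability.
Context {R : realType}.
Implicit Types (r s t : R) (X : cadlag R).

Lemma measurable_addb d (T : measurableType d) (f g : T -> bool) :
  measurable_fun setT f -> measurable_fun setT g ->
  measurable_fun setT (fun x => f x (+) g x).
Proof.
move=> mf mg; apply: (eq_measurable_fun (fun x => if f x then ~~ g x else g x)).
  by move=> x _; case: (f x).
by apply: measurable_fun_ifT => //; exact: measurable_neg.
Qed.

Lemma measurable_coordinate s t : 0 <= t <= s ->
  measurable_fun setT (fun X : g_sigma_algebraType (coordinates s) => X t).
Proof.
move=> ts; apply: (@measurable_fun_bool _ _ _ _ true).
rewrite setTI; apply: sub_sigma_algebra; exists t, true; split => //.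
Qed.

Lemma measurable_path_coordinate t : 0 <= t <= 1 ->
  measurable_fun setT (fun X : path_space R => X t).
Proof. exact: measurable_coordinate. Qed.

Lemma measurable_clip : measurable_fun setT (@clip R : measurableTypeR R -> R).
Proof.
apply: measurable_fun_ifT => //.
by apply: measurable_and; apply: measurable_fun_ltr => //.
Qed.

Definition flip_pair (p : path_space R * measurableTypeR R) : path_space R :=
  flip p.2 p.1.

Lemma measurable_flip_pair : measurable_fun setT flip_pair.
Proof.
have E : @measurable _ (path_space R) = <<s @coordinates R 1 >> by [].
apply: (measurability _ E).
move=> _ [_ [u [x [u01 ->]]] <-].
have mf : measurable_fun setT
    (fun p : path_space R * measurableTypeR R => p.1 u (+) jump_after p.2 u).
  apply: measurable_addb.
    exact: measurableT_comp (measurable_path_coordinate u01) measurable_fst.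
  apply: measurable_and => //; apply: measurable_fun_ler => //.
  exact: measurableT_comp measurable_clip measurable_snd.
exact: (mf measurableT [set x]).
Qed.

HB.instance Definition _ :=
  isMeasurableFun.Build _ _ _ _ flip_pair measurable_flip_pair.

Definition jump_law (mu : probability (path_space R) R) :
    probability (path_space R) R :=
  distribution (mu \x @unit_law R)%E flip_pair.

Fixpoint jumps_law k : probability (path_space R) R :=
  if k is k'.+1 then jump_law (jumps_law k') else \d_(zero_path R : path_space R).

Definition close X : cadlag R := if X 1 then flip 2^-1 X else X.

(** Unlike [jump_set], measurable on the whole path space: the sigma-algebra of
    even sets only controls [jump_set] on the bridges. *)
Definition bridge_set X : evenset R :=
  if X 0 || X 1 then evenset0 R else jump_set X.

Lemma measurable_flip r :
  measurable_fun setT (flip r : path_space R -> path_space R).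
Proof. exact: (measurable_fun_pair1 r measurable_flip_pair). Qed.

Lemma measurable_close :
  measurable_fun setT (close : path_space R -> path_space R).
Proof.
apply: measurable_fun_ifT; last by [].
  by apply: measurable_path_coordinate; rewrite ler01 lexx.
exact: measurable_flip.
Qed.

Lemma measurable_bridge_set :
  measurable_fun setT (bridge_set : path_space R -> evenset R).
Proof.
apply: measurable_fun_if => //.
  by apply: measurable_or; apply: measurable_path_coordinate; rewrite ler01 lexx.
rewrite setTI (_ : _ @^-1` _ = @bridge_paths R); first by move=> ? A.
apply/seteqP; split=> X /=; rewrite /bridge_paths /state_at /=.
  by case: (X 0) (X 1) => [] [].
by move=> [-> ->].
Qed.

(** An extension of [jump_set] from the bridges to all paths that start at 0.
    It allows even sets to be compared before and after a single flip. *)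
Definition pin X : evenset R := bridge_set (close X).

Lemma measurable_pin : measurable_fun setT (pin : path_space R -> evenset R).
Proof. exact: measurableT_comp measurable_bridge_set measurable_close. Qed.

Lemma pin_bridge X : bridge_paths X -> pin X = jump_set X.
Proof. by rewrite /pin /bridge_set /close => -[X0 X1]; rewrite X1 X0 X1. Qed.

(** Of [X] and [flip r X] exactly one ends at 0; the other one is closed by a
    flip at 1/2, so that the two bridges differ by the flips at [r] and at
    1/2. *)
Lemma lipschitz_pin f r X : graph_lipschitz f ->
  `|f (pin (flip r X)) - f (pin X)| <= 2.
Proof.
move=> f_lip; have [X0|/negbTE X0] := boolP (X 0).
  suff pin0 (Y : cadlag R) : Y 0 -> pin Y = evenset0 R.
    by rewrite !pin0 ?flip0// subrr normr0.
  by move=> Y0; rewrite /pin /bridge_set /close; case: (Y 1); rewrite ?flip0 Y0.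
rewrite /pin /close flip1; case: (boolP (X 1)) => [X1|/negbTE X1] /=;
  rewrite /bridge_set ?flip0 ?flip1 X0 X1 /=.
  rewrite -{1}[X](flipK 2^-1); exact: lipschitz_jump_set.
exact: lipschitz_jump_set.
Qed.

End measurability.

(** * Characters of the path space *)

Section walsh.
Context {R : realType}.
Implicit Types (r s t : R) (X : cadlag R) (l : seq R) (c : seq (R * bool)).

Definition parity l X : bool := \big[addb/false]_(t <- l) X t.

Definition parity_set l b : set (cadlag R) := [set X | parity l X = b].

Definition cylinder c : set (cadlag R) := [set X | all (fun p => X p.1 == p.2) c].

Lemma measurable_parity s l b : {in l, forall t, 0 <= t <= s} ->
  measurable (parity_set l b : set (g_sigma_algebraType (coordinates s))).
Proof.
move=> ls; rewrite -[X in measurable X]setTI.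
suff mp : measurable_fun setT
  (parity l : g_sigma_algebraType (coordinates s) -> bool).
  exact: (mp measurableT [set b]).
elim: l ls => [|t l IH] ls.
  by apply: (eq_measurable_fun (cst false)) => // X _; rewrite /parity big_nil.
apply: (eq_measurable_fun (fun X : g_sigma_algebraType (coordinates s) =>
    (X : cadlag R) t (+) parity l X)).
  by move=> X _; rewrite /parity big_cons.
apply: measurable_addb; first by apply: measurable_coordinate; apply: ls;
  rewrite mem_head.
by apply: IH => u ul; apply: ls; rewrite inE ul orbT.
Qed.

Lemma measurable_cylinder c : {in c, forall p, 0 <= p.1 <= 1} ->
  measurable (cylinder c : set (path_space R)).
Proof.
elim: c => [|p c IH] c01.
  by rewrite (_ : cylinder _ = setT)//; apply/seteqP; split.
rewrite (_ : cylinder _ = state_at p.1 p.2 `&` cylinder c); last first.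
  by apply/seteqP; split=> X; rewrite /cylinder /state_at /=;
    [move=> /andP[/eqP]|move=> [-> ->]; rewrite eqxx].
apply: measurableI; first by apply: measurable_state_at; apply: c01;
  rewrite mem_head.
by apply: IH => q qc; apply: c01; rewrite inE qc orbT.
Qed.

(** The integral of the character (-1)^(parity l) over the cylinder [c]. *)
Definition walsh (mu : set (path_space R) -> \bar R) l c : R :=
  fine (mu (parity_set l false `&` cylinder c)) -
  fine (mu (parity_set l true `&` cylinder c)).

Lemma fine_measureD d (T : measurableType d)
    (mu : {finite_measure set T -> \bar R}) (A B : set T) :
  measurable A -> measurable B -> A `&` B = set0 ->
  fine (mu (A `|` B)) = fine (mu A) + fine (mu B).
Proof.
by move=> mA mB AB; rewrite measureU// fineD//; apply: fin_num_measure.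
Qed.

(** The indicator of [X t = x] is half the sum of 1 and (-1)^x (-1)^(X t).  By
    iteration, the integrals of characters determine the measures of
    cylinders. *)
Lemma walsh_cylinder_cons (mu : {finite_measure set (path_space R) -> \bar R})
    l c t x : {in l, forall t, 0 <= t <= 1} -> {in c, forall p, 0 <= p.1 <= 1} ->
  0 <= t <= 1 ->
  walsh mu l ((t, x) :: c) =
  (walsh mu l c + (if x then - walsh mu (t :: l) c else walsh mu (t :: l) c)) / 2.
Proof.
move=> l01 c01 t01; pose E b y : set (path_space R) :=
  parity_set l b `&` cylinder c `&` state_at t y.
have mE b y : measurable (E b y).
  apply: measurableI; last exact: measurable_state_at.
  by apply: measurableI; [exact: measurable_parity|exact: measurable_cylinder].
have disj b b' y y' : (b, y) != (b', y') -> E b y `&` E b' y' = set0.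
  move=> by'; rewrite -subset0 => X [[[lb _] ty] [[lb' _] ty']].
  case/eqP: by'.
  by move: lb lb' ty ty'; rewrite /parity_set/state_at/= => <- <- <- <-.
have cons b : parity_set l b `&` cylinder ((t, x) :: c) = E b x.
  apply/seteqP; split=> X; rewrite /E /cylinder /state_at /=.
    by case=> lb /andP[/eqP tx cX]; split => //.
  by case=> -[lb cX] ->; rewrite eqxx.
have split_t b : parity_set l b `&` cylinder c = E b false `|` E b true.
  apply/seteqP; split=> X /=; rewrite /E /=.
    by move=> [lb cX]; case tX : (X t); [right|left].
  by case=> -[].
have split_tl b : parity_set (t :: l) b `&` cylinder c = E b false `|` E (~~ b) true.
  apply/seteqP; split=> X /=; rewrite /E /parity_set /parity /= big_cons.
    by move=> [lb cX]; case tX : (X t); [right|left]; split => //; split => //=;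
      rewrite -lb tX ?negbK.
  by case=> -[[lb cX]]; rewrite /state_at/= => ->; rewrite lb //= negbK.
rewrite /walsh !cons !split_t !split_tl !fine_measureD ?disj//.
by case: x {cons} => /=; lra.
Qed.

Lemma parity_flip r l X :
  parity l (flip r X) = parity l X (+) \big[addb/false]_(t <- l) jump_after r t.
Proof. by rewrite /parity -big_split. Qed.

(** The times at which a flip changes the sign of the character of [l]. *)
Definition odd_region l : set (measurableTypeR R) :=
  [set r | \big[addb/false]_(t <- l) jump_after r t].

Definition flip_prob l : R := fine (@unit_law R (odd_region l)).

Lemma measurable_odd_region l : measurable (odd_region l).
Proof.
rewrite -[X in measurable X]setTI.
suff mp : measurable_fun setT (fun r : measurableTypeR R =>
    \big[addb/false]_(t <- l) jump_after r t).
  have -> : odd_region l = (fun r : measurableTypeR R =>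
    \big[addb/false]_(t <- l) jump_after r t) @^-1` [set true] by [].
  exact: mp.
elim: l => [|t l IH].
  by apply: (eq_measurable_fun (cst false)) => // r _; rewrite big_nil.
apply: (eq_measurable_fun (fun r : measurableTypeR R => jump_after r t (+)
    \big[addb/false]_(t <- l) jump_after r t)).
  by move=> r _; rewrite big_cons.
apply: measurable_addb => //; apply: measurable_and => //.
by apply: measurable_fun_ler => //; exact: measurable_clip.
Qed.

Lemma cylinder_nil : cylinder [::] = setT.
Proof. by apply/seteqP; split. Qed.

Lemma parity_set_nil b : parity_set [::] b = if b then set0 else setT.
Proof.
by apply/seteqP; split=> X; rewrite /parity_set /parity /= big_nil; case: b.
Qed.

Lemma walsh_nil (mu : {measure set (path_space R) -> \bar R}) c :
  walsh mu [::] c = fine (mu (cylinder c)).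
Proof. by rewrite /walsh !parity_set_nil setTI set0I measure0 subr0. Qed.

(** A flip at [r] multiplies the character by a sign that depends on [r] only,
    hence its integral by the mean of this sign. *)
Lemma walsh_jump_law (mu : probability (path_space R) R) l :
  {in l, forall t, 0 <= t <= 1} ->
  walsh (jump_law mu) l [::] = walsh mu l [::] * (1 - 2 * flip_prob l).
Proof.
move=> l01; have mO := measurable_odd_region l.
pose M : probability (path_space R * measurableTypeR R)%type R :=
  (mu \x @unit_law R)%E.
have mpar b : measurable (parity_set l b : set (path_space R)).
  exact: measurable_parity.
have split_par b : fine (jump_law mu (parity_set l b)) =
    fine (mu (parity_set l b)) * (1 - flip_prob l) +
    fine (mu (parity_set l (~~ b))) * flip_prob l.
  have -> : jump_law mu (parity_set l b) =
    M (@flip_pair R @^-1` parity_set l b) by [].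
  have -> : @flip_pair R @^-1` parity_set l b =
      (parity_set l b `*` ~` odd_region l) `|`
      (parity_set l (~~ b) `*` odd_region l).
    apply/seteqP; split=> -[X r] /=;
      rewrite /flip_pair /parity_set /= parity_flip /odd_region /=.
      by case: (\big[_/_]_(_ <- _) _) => <-; [right|left];
        rewrite ?addbT ?addbF ?negbK.
    by case=> -[-> ]; case: (\big[_/_]_(_ <- _) _) => //;
      rewrite ?addbT ?addbF ?negbK.
  rewrite fine_measureD; last 3 first.
  - by apply: measurableX => //; exact: measurableC.
  - exact: measurableX.
  - by rewrite -subset0 => -[X r] /= [[_ ?] []].
  rewrite /M /= !product_measure1E//; last exact: measurableC.
  rewrite !fineM ?fin_num_measure//; last exact: measurableC.
  congr (_ * _ + _ * _).
  transitivity (fine (1 - @unit_law R (odd_region l))%E).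
    by congr fine; exact: probability_setC.
  by rewrite fineB// fin_num_measure.
rewrite /walsh cylinder_nil !setIT !split_par /=; lra.
Qed.

Lemma walsh_jumps_law k l : {in l, forall t, 0 <= t <= 1} ->
  walsh (jumps_law k) l [::] = (1 - 2 * flip_prob l) ^+ k.
Proof.
move=> l01; elim: k => [|k IH]; last by rewrite walsh_jump_law// IH exprSr.
have law0 (A : set (path_space R)) :
    jumps_law 0 A = ((zero_path R \in A)%:R)%:E :> \bar R.
  by rewrite /= /dirac indicE.
have par0 : parity l (zero_path R) = false by rewrite /parity big1_idem.
rewrite /walsh cylinder_nil !setIT !law0 expr0 mem_set//= memNset/= ?subr0//.
by rewrite /parity_set/= par0.
Qed.

End walsh.

(** * The Markov property and characters *)

Section random_walk.
Context {R : realType}.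
Implicit Types (r s t a : R) (X : cadlag R) (l : seq R) (c : seq (R * bool)).

Lemma flip_prob_perm l l' : perm_eq l l' -> flip_prob l = flip_prob l'.
Proof.
move=> ll'; rewrite /flip_prob (_ : odd_region l = odd_region l')//.
by apply/seteqP; split=> r; rewrite /odd_region /= (perm_big _ ll').
Qed.

Lemma flip_prob_nil : flip_prob [::] = 0 :> R.
Proof.
rewrite /flip_prob (_ : odd_region _ = set0) ?measure0//.
by rewrite -subset0 => r; rewrite /odd_region /= big_nil.
Qed.

Lemma flip_prob_cons0 l : flip_prob (0 :: l) = flip_prob l.
Proof.
rewrite /flip_prob (_ : odd_region _ = odd_region l)//.
have after0 r : jump_after r 0 = false.
  by rewrite /jump_after leNgt; case/andP: (clip_itv r) => ->.
by apply/seteqP; split=> r; rewrite /odd_region /= big_cons after0.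
Qed.

Lemma unit_law_oc s t : 0 <= s -> s <= t -> t <= 1 ->
  @unit_law R `]s, t] = (t - s)%:E.
Proof.
move=> s0 st t1; rewrite /unit_law /mrestr.
have [->|tneq1] := eqVneq t 1.
  rewrite (_ : _ `&` _ = `]s, 1[%classic).
    rewrite lebesgue_measure_itv/= lte_fin; case: ltP => [_|s1];
      first by rewrite EFinD.
    by rewrite (@le_anti _ _ s 1) ?subrr// s1 (le_trans st).
  apply/seteqP; split=> r /=; rewrite !in_itv/=.
    by move=> [/andP[-> _] /andP[_ ->]].
  by move=> /andP[sr r1]; rewrite sr (ltW r1) (le_lt_trans s0 sr).
have {}t1 : t < 1 by rewrite lt_neqAle tneq1.
rewrite (_ : _ `&` _ = `]s, t]%classic).
  rewrite lebesgue_measure_itv/= lte_fin; case: ltP => [_|ts];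
    first by rewrite EFinD.
  by rewrite (@le_anti _ _ s t) ?subrr// st.
apply/seteqP; split=> r /=; rewrite !in_itv/=; first by case.
by move=> /andP[sr rt]; rewrite sr rt (le_lt_trans s0 sr) (le_lt_trans rt).
Qed.

(** A flip at [r] changes the states from time [r] on.  If [r <= s], it changes
    both [X s] and [X t], and the two signs cancel; if [s < r <= t], it
    changes [X t] alone. *)
Lemma flip_prob_rcons2 l s t : {in l, forall u, u <= s} ->
  0 <= s -> s <= t -> t <= 1 ->
  flip_prob (rcons (rcons l s) t) = flip_prob l + (t - s).
Proof.
move=> ls s0 st t1.
have mO := @measurable_odd_region R.
have mI : measurable (`]s, t]%classic :
  set (measurableTypeR R)) by exact: measurable_itv.
have below r : 0 < r < 1 -> s < r ->
    \big[addb/false]_(u <- l) jump_after r u = false.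
  move=> r01 sr; rewrite big_seq big1_idem// => u ul.
  by rewrite /jump_after clip_id// leNgt (le_lt_trans (ls u ul)).
have regionE r : 0 < r < 1 ->
    odd_region (rcons (rcons l s) t) r <-> odd_region l r \/ `]s, t]%classic r.
  move=> r01; rewrite /odd_region /= -!cats1 !big_cat !big_seq1 /= in_itv /=.
  rewrite {2 3}/jump_after clip_id// t1 (le_trans st t1) !andbT [s < r]ltNge.
  have [rs|sr] := leP r s; first by rewrite (le_trans rs st) /= -addbA addbb
    addbF; split; [left|case].
  rewrite below//=; split; first by right.
  by case.
rewrite /flip_prob /unit_law /mrestr.
rewrite (_ : odd_region (rcons _ _) `&` _ =
  (odd_region l `&` `]0, 1[) `|` (`]s, t] `&` `]0, 1[)); last first.
  apply/seteqP; split=> r /=; rewrite in_itv/=.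
    by move=> [/regionE h r01]; case: (h r01); [left|right].
  by case=> -[h r01]; split => //; apply/regionE => //; [left|right].
rewrite measureU//; last 3 first.
- by apply: measurableI => //; exact: measurable_itv.
- by apply: measurableI => //; exact: measurable_itv.
- rewrite -subset0 => r /= [[lr]]; rewrite !in_itv /= => r01 [/andP[sr _] _].
  by move: lr; rewrite /odd_region /= below.
rewrite fineD; last 2 first.
- by apply: (fin_num_measure (@unit_law R)).
- by apply: (fin_num_measure (@unit_law R)).
by congr (_ + _); rewrite -[t - s]/(fine (t - s)%:E) -unit_law_oc.
Qed.

(** By the Kolmogorov equation this difference is a solution of
    [y' = - 2 a y]. *)
Lemma transition_decay a p t x : transition_function a p ->
  p t x x - p t x (~~ x) = expR (- (2 * a * t)).
Proof.
move=> [p0 dp].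
have rate u : \sum_z p u x z * generator a z x -
    \sum_z p u x z * generator a z (~~ x) = - (2 * a) * (p u x x - p u x (~~ x)).
  by rewrite !big_bool /generator; case: x => /=; ring.
pose g u := (p u x x - p u x (~~ x)) * expR (2 * a * u).
have dg u : is_derive u (1 : R) g 0.
  have dx := dp u x x; have dnx := dp u x (~~ x).
  have dlin : is_derive u (1 : R) (fun v : R => 2 * a * v) (2 * a).
    by apply: is_derive_eq; rewrite /GRing.scale /= mulr1.
  have de := is_derive1_comp _ dlin.
  apply: is_derive_eq; rewrite /GRing.scale /= rate; ring.
have g0 : g t = g 0 by exact: is_derive_0_is_cst.
move: g0; rewrite /g !p0 mulr0 expR0 mulr1 eqxx.
have -> : (x == ~~ x) = false by case: (x).
rewrite subr0 => g1.
by rewrite expRN -[RHS]mul1r; apply: (canRL (mulfK _)); rewrite ?gt_eqF ?expR_gt0.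
Qed.

Lemma fine_measure_split (mu : {finite_measure set (path_space R) -> \bar R})
    (A : set (path_space R)) t : measurable A -> 0 <= t <= 1 ->
  fine (mu A) = fine (mu (A `&` state_at t false)) +
                fine (mu (A `&` state_at t true)).
Proof.
move=> mA t01; rewrite -fine_measureD.
- congr (fine (mu _)); apply/seteqP; split=> X /=; last by case=> -[].
  by move=> AX; rewrite /state_at /=; case: (X t); [right|left].
- by apply: measurableI => //; exact: measurable_state_at.
- by apply: measurableI => //; exact: measurable_state_at.
- by rewrite -subset0 => X [[_ Xf] [_]]; rewrite /state_at /= Xf.
Qed.

Section markov.
Variables (a : R) (P : probability (path_space R) R).
Hypothesis P_walk : random_walk_law a P.

Let m0 : measurable (state_at 0 false : set (path_space R)).
Proof. by apply: measurable_state_at; rewrite lexx ler01. Qed.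

(** The law of the walk restricted to the paths that start at 0, without
    normalization. *)
Definition started : set (path_space R) -> \bar R := mrestr P m0.

HB.instance Definition _ := FiniteMeasure.on started.

Lemma startedE (A : set (path_space R)) :
  started A = P (A `&` state_at 0 false).
Proof. by []. Qed.

(** Given the history up to time [s], the mean of (-1)^(X s + X t) is
    [p x x - p x (~~ x)] whatever the state [x] at time [s]. *)
Lemma walsh_started_rcons2 l s t : {in l, forall u, 0 <= u <= s} ->
  0 <= s -> s <= t -> t <= 1 ->
  walsh started (rcons (rcons l s) t) [::] =
  expR (- (2 * a * (t - s))) * walsh started l [::].
Proof.
move=> ls s0 st t1; have [p tp markov] := P_walk.
have s1 := le_trans st t1; have t0 := le_trans s0 st.
have l01 : {in l, forall u, 0 <= u <= 1}.
  by move=> u /ls /andP[-> us]; rewrite (le_trans us s1).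
have lst01 : {in rcons (rcons l s) t, forall u, 0 <= u <= 1}.
  move=> u; rewrite mem_rcons inE mem_rcons inE.
  by case/orP=> [/eqP->|/orP[/eqP->|/l01//]]; rewrite ?t0 ?s0.
pose H b : set (cadlag R) := parity_set l b `&` state_at 0 false.
have hH b : history s (H b).
  suff : measurable (H b : set (g_sigma_algebraType (coordinates s))) by [].
  apply: measurableI; first exact: measurable_parity.
  by apply: sub_sigma_algebra; exists 0, false; rewrite lexx.
pose h b x := fine (P (H b `&` state_at s x)).
have mpar l' b : {in l', forall u, 0 <= u <= 1} ->
  measurable (parity_set l' b : set (path_space R)) by exact: measurable_parity.
have s01 : 0 <= s <= 1 by rewrite s0.
have t01 : 0 <= t <= 1 by rewrite t0.
have joint b x y : fine (P (H b `&` state_at s x `&` state_at t y)) =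
    h b x * p (t - s) x y.
  rewrite markov// fineM// fin_num_measure//.
  apply: measurableI; last exact: measurable_state_at.
  by apply: measurableI => //; exact: mpar.
have lE b : fine (started (parity_set l b)) = h b false + h b true.
  rewrite (@fine_measure_split started _ s)//; last exact: mpar.
  by congr (fine (P _) + fine (P _)); rewrite setIAC.
have lstE b : fine (started (parity_set (rcons (rcons l s) t) b)) =
  h b false * p (t - s) false false + h (~~ b) false * p (t - s) false true +
  (h (~~ b) true * p (t - s) true false + h b true * p (t - s) true true).
  have atomE x y : parity_set (rcons (rcons l s) t) b `&` state_at s x
      `&` state_at t y `&` state_at 0 false =
      H (b (+) x (+) y) `&` state_at s x `&` state_at t y.
    apply/seteqP; split=> X; rewrite /H /parity_set /state_at /parity /=
      -!cats1 !big_cat !big_seq1 /=.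
      by move=> [[[<- <-] <-] ->]; rewrite addbAC !addbK.
    by move=> [[[-> ->] <-] <-]; rewrite addbAC !addbK.
  rewrite (@fine_measure_split started _ s)//; last exact: mpar.
  rewrite !(@fine_measure_split started (_ `&` state_at s _) t)//; last 2 first.
  - by apply: measurableI; [exact: mpar|exact: measurable_state_at].
  - by apply: measurableI; [exact: mpar|exact: measurable_state_at].
  have startedE' x y : fine (started (parity_set (rcons (rcons l s) t) b `&`
      state_at s x `&` state_at t y)) = h (b (+) x (+) y) x * p (t - s) x y.
    by rewrite startedE atomE joint.
  rewrite !startedE'.
  by case: b {atomE startedE'}.
have e x := transition_decay (t - s) x tp.
rewrite /walsh cylinder_nil !setIT !lE !lstE /=.
have := e true; have := e false => /= <- e1.
by rewrite -[p (t - s) true true](subrK (p (t - s) true false)) e1; ring.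
Qed.

End markov.

End random_walk.

(** * Integrals under mixtures and perturbations *)

Section integrals.
Context {R : realType}.

Lemma integral_perturbation d (T : measurableType d) (M : probability T R)
    (g h : T -> R) (C : R) : measurable_fun setT g -> measurable_fun setT h ->
  (forall x, `|h x - g x| <= C) -> M.-integrable setT (EFin \o g) ->
  M.-integrable setT (EFin \o h) /\
  `|fine (\int[M]_x (h x)%:E) - fine (\int[M]_x (g x)%:E)| <= C.
Proof.
move=> mg mh ghC ig.
have mD : measurable_fun setT (h \- g) by exact: measurable_funB.
have iC : M.-integrable setT (EFin \o cst C) by exact: finite_measure_integrable_cst.
have C0 : 0 <= C by exact: le_trans (ghC point).
have iD : M.-integrable setT (EFin \o (h \- g)).
  apply: (le_integrable measurableT _ _ iC); first exact/measurable_EFinP.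
  by move=> x _; rewrite /= lee_fin (ger0_norm C0).
have ih : M.-integrable setT (EFin \o h).
  rewrite (_ : EFin \o h = ((EFin \o g) \+ (EFin \o (h \- g)%R))%E); last first.
    by apply/funext => x /=; rewrite -EFinD addrC subrK.
  exact: integrableD.
split=> //; rewrite -fineB; [|exact: integrable_fin_num|exact: integrable_fin_num].
rewrite -(integralB measurableT ih ig) -lee_fin -fine_abse; last first.
  exact: (integrable_fin_num measurableT iD).
rewrite fineK ?abse_fin_num; last exact: (integrable_fin_num measurableT iD).
apply: le_trans (le_abse_integral _ _ _) _ => //; first exact/measurable_EFinP.
apply: (@le_trans _ _ (\int[M]_x (cst C%:E x))%E).
  apply: ge0_le_integral => //.
  - apply: measurableT_comp => //; apply: emeasurable_funB; exact/measurable_EFinP.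
  - by move=> x _; rewrite /= lee_fin.
rewrite integral_cst// -[leRHS]mule1 le_eqVlt; apply/orP; left; apply/eqP.
congr (_ * _)%E; exact: probability_setT.
Qed.

Lemma eseries_EFin (u : R^nat) (x : R) : series u @ \oo --> x ->
  (\sum_(k <oo) (u k)%:E = x%:E)%E.
Proof.
move=> ux; rewrite (_ : (fun n => _) = EFin \o series u); last first.
  by apply/funext => n; rewrite /= /series sumEFin.
by apply/cvg_lim => //; apply: cvg_EFin => //; apply: nearW.
Qed.

Lemma nneseries_EFin_cvg (u : R^nat) (x : R) : (forall k, 0 <= u k) ->
  (\sum_(k <oo) (u k)%:E = x%:E)%E -> series u @ \oo --> x.
Proof.
move=> u0 ux; rewrite (_ : series u =
  fine \o (fun n => \sum_(0 <= k < n) (u k)%:E)%E).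
  by apply: fine_cvg; rewrite -ux; apply: is_cvg_nneseries => k _ _; rewrite lee_fin.
by apply/funext => n; rewrite /series /= sumEFin.
Qed.

Section mixture.
Context d (T : measurableType d) (mu : {measure set T -> \bar R})
  (eta : nat -> {measure set T -> \bar R}) (w : nat -> R).
Hypotheses (w_ge0 : forall k, 0 <= w k)
  (muE : forall A, measurable A -> (mu A = \sum_(k <oo) (w k)%:E * eta k A)%E).

Lemma ge0_integral_mixture (g : T -> \bar R) : measurable_fun setT g ->
  (forall x, 0 <= g x)%E ->
  (\int[mu]_x g x = \sum_(k <oo) (w k)%:E * \int[eta k]_x g x)%E.
Proof.
move=> mg g0.
pose m k : {measure set T -> \bar R} := mscale (NngNum (w_ge0 k)) (eta k).
rewrite (eq_measure_integral (mseries m 0)); last by move=> A mA _; exact: muE.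
rewrite ge0_integral_measure_series//; apply: eq_eseriesr => k _.
by rewrite ge0_integral_mscale.
Qed.

Lemma ge0_integral_mixture_cvg (g : T -> \bar R) : measurable_fun setT g ->
  (forall x, 0 <= g x)%E -> (\int[mu]_x g x)%E \is a fin_num ->
  (forall k, (\int[eta k]_x g x)%E \is a fin_num) ->
  [series w k * fine (\int[eta k]_x g x)%E]_k @ \oo --> fine (\int[mu]_x g x)%E.
Proof.
move=> mg g0 mufin etafin.
apply: nneseries_EFin_cvg => [k|].
  by rewrite mulr_ge0// fine_ge0// integral_ge0.
rewrite fineK// ge0_integral_mixture//; apply: eq_eseriesr => k _.
by rewrite EFinM fineK.
Qed.

Lemma integral_mixture_cvg (f : T -> R) : mu.-integrable setT (EFin \o f) ->
  (forall k, (eta k).-integrable setT (EFin \o f)) ->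
  [series w k * fine (\int[eta k]_x (f x)%:E)%E]_k @ \oo -->
  fine (\int[mu]_x (f x)%:E)%E.
Proof.
move=> imu ieta; have mf := measurable_int _ imu.
have fineE (nu : {measure set T -> \bar R}) : nu.-integrable setT (EFin \o f) ->
    fine (\int[nu]_x (f x)%:E)%E =
    fine (\int[nu]_x (EFin \o f)^\+ x)%E - fine (\int[nu]_x (EFin \o f)^\- x)%E.
  move=> inu; rewrite -fineB; last 2 first.
  - exact: integrable_pos_fin_num.
  - exact: integrable_neg_fin_num.
  by rewrite -integralE.
rewrite fineE// (_ : [series _]_k =
  [series w k * fine (\int[eta k]_x (EFin \o f)^\+ x)%E]_k \-
  [series w k * fine (\int[eta k]_x (EFin \o f)^\- x)%E]_k); last first.
  apply/funext => n; rewrite /series /= -sumrB; apply: eq_bigr => k _.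
  by rewrite fineE// mulrBr.
apply: cvgB; apply: ge0_integral_mixture_cvg => //.
- exact: measurable_funepos.
- exact: integrable_pos_fin_num.
- by move=> k; exact: integrable_pos_fin_num.
- exact: measurable_funeneg.
- exact: integrable_neg_fin_num.
- by move=> k; exact: integrable_neg_fin_num.
Qed.

End mixture.

End integrals.

(** * The walk as a Poisson mixture of uniform flips *)

Section mixture.
Context {R : realType}.
Implicit Types (r s t : R) (X : cadlag R) (l : seq R) (c : seq (R * bool)).
Variables (a : R) (P : probability (path_space R) R).
Hypotheses (a_ge0 : 0 <= a) (P_walk : random_walk_law a P).

Let p0 : R := fine (P (state_at 0 false)).

Lemma walsh_started_perm l l' : perm_eq l l' ->
  walsh (started P) l [::] = walsh (started P) l' [::].
Proof.
move=> ll'; rewrite /walsh; suff E b :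
  parity_set l b = parity_set l' b by rewrite !E.
by apply/seteqP; split=> X; rewrite /parity_set /parity /= (perm_big _ ll').
Qed.

Lemma walsh_started_cons0 l : walsh (started P) (0 :: l) [::] =
  walsh (started P) l [::].
Proof.
rewrite /walsh !startedE; suff E b : parity_set (0 :: l) b `&` cylinder [::] `&`
  state_at 0 false = parity_set l b `&` cylinder [::] `&` state_at 0 false by
    rewrite !E.
apply/seteqP; split=> X; rewrite /parity_set /parity /state_at /= big_cons.
  by move=> [[<- ?] ->]; rewrite addFb.
by move=> [[<- ?] ->]; rewrite addFb.
Qed.

(** The last two times of the sorted list are removed together, with the same
    effect on both sides.  This requires an even number of times: as [X 0 = 0],
    the time 0 can be added to a list of odd length. *)
Lemma walsh_started l : {in l, forall t, 0 <= t <= 1} ->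
  walsh (started P) l [::] = p0 * expR (- (2 * a * flip_prob l)).
Proof.
have even_sorted n l' : size l' = n.*2 -> sorted <=%R l' ->
    {in l', forall t, 0 <= t <= 1} ->
    walsh (started P) l' [::] = p0 * expR (- (2 * a * flip_prob l')).
  elim: n l' => [|n IH] l'.
    move=> /size0nil -> _ _; rewrite flip_prob_nil mulr0 oppr0 expR0 mulr1.
    rewrite walsh_nil cylinder_nil.
    by rewrite -[RHS]/(fine (P (state_at 0 false))) -[in RHS](setTI (state_at 0
      false)).
  case/lastP: l' => // l' t; case/lastP: l' => [|l' s]; first by case: n {IH}.
  rewrite !size_rcons doubleS => -[/IH{}IH].
  rewrite (sorted_pairwise (@le_trans _ R)) !pairwise_rcons -(sorted_pairwise
    (@le_trans _ R)).
  rewrite all_rcons => /and3P[/andP[st _] /allP ls l_sorted] l01.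
  have in01 u : u \in rcons (rcons l' s) t -> 0 <= u <= 1 by exact: l01.
  have /andP[s0 s1] : 0 <= s <= 1 by apply: l01;
    rewrite mem_rcons inE mem_rcons mem_head orbT.
  have /andP[t0 t1] : 0 <= t <= 1 by apply: l01; rewrite mem_rcons mem_head.
  have l'01 : {in l', forall u, 0 <= u <= 1}.
    by move=> u ul; apply: l01; rewrite mem_rcons inE mem_rcons inE ul !orbT.
  rewrite (walsh_started_rcons2 P_walk)//; last first.
    by move=> u ul; have /andP[-> _] := l'01 _ ul; exact: ls.
  rewrite IH// flip_prob_rcons2//.
  by rewrite mulrCA -expRD; congr (_ * expR _); ring.
move=> l01.
have sort01 : {in sort <=%R l, forall t, 0 <= t <= 1}.
  by move=> t; rewrite mem_sort; exact: l01.
have perm : perm_eq (sort <=%R l) l by rewrite perm_sort.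
have sorted_l := sort_sorted (@le_total _ R) l.
rewrite -(walsh_started_perm perm) -(flip_prob_perm perm).
have := odd_double_half (size (sort <=%R l)); case: odd => /= sz.
  rewrite -walsh_started_cons0 -flip_prob_cons0;
    apply: (@even_sorted (size (sort <=%R l))./2.+1).
  - by rewrite /= -{1}sz add1n doubleS.
  - rewrite /= path_min_sorted//; apply/allP => t /sort01; by case/andP.
  - by move=> t; rewrite inE => /orP[/eqP->|/sort01//]; rewrite lexx ler01.
by apply: (@even_sorted (size (sort <=%R l))./2).
Qed.

Definition jump_weight k : R := p0 * expR (- a) * (a ^+ k / k`!%:R).

Lemma jump_weight_ge0 k : 0 <= jump_weight k.
Proof.
by rewrite !mulr_ge0 ?expR_ge0 ?invr_ge0 ?exprn_ge0// fine_ge0.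
Qed.

(** For the empty cylinder this is the exponential series at
    [a * (1 - 2 * flip_prob l)]; the general case follows since both sides
    obey the linear recursion [walsh_cylinder_cons]. *)
Lemma walsh_series l c : {in l, forall t, 0 <= t <= 1} ->
  {in c, forall p, 0 <= p.1 <= 1} ->
  [series jump_weight k * walsh (jumps_law k) l c]_k @ \oo -->
  walsh (started P) l c.
Proof.
elim: c l => [|[t x] c IH] l l01 c01.
  rewrite walsh_started//.
  have -> : [series jump_weight k * walsh (jumps_law k) l [::]]_k =
      fun n => p0 * expR (- a) * series (exp_coeff (a * (1 - 2 * flip_prob l))) n.
    apply/funext => n; rewrite /series /= big_distrr; apply: eq_bigr => k _.
    by rewrite walsh_jumps_law// /jump_weight /exp_coeff /= exprMn; ring.
  have -> : - (2 * a * flip_prob l) = - a + a * (1 - 2 * flip_prob l) by ring.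
  rewrite expRD mulrA; apply: cvgMr; exact: is_cvg_series_exp_coeff.
have t01 : 0 <= t <= 1 by exact: (c01 (t, x) (mem_head _ _)).
have {}c01 : {in c, forall p, 0 <= p.1 <= 1}.
  by move=> p pc; apply: c01; rewrite inE pc orbT.
have tl01 : {in t :: l, forall t, 0 <= t <= 1}.
  by move=> u; rewrite inE => /orP[/eqP->|/l01].
have cl := IH _ l01 c01; have ctl := IH _ tl01 c01.
rewrite walsh_cylinder_cons//.
have -> : [series jump_weight k * walsh (jumps_law k) l ((t, x) :: c)]_k =
  fun n => ([series jump_weight k * walsh (jumps_law k) l c]_k n +
    (-1) ^+ x * [series jump_weight k * walsh (jumps_law k) (t :: l) c]_k n) / 2.
  apply/funext => n; rewrite /series /= mulrDl big_distrl /= big_distrr /=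
    big_distrl /=.
  rewrite -big_split /=; apply: eq_bigr => k _; rewrite walsh_cylinder_cons//.
  by case: (x) => /=; rewrite ?expr1 ?expr0; ring.
have -> : (if x then - walsh (started P) (t :: l) c else walsh (started P) (t
  :: l) c) =
  (-1) ^+ x * walsh (started P) (t :: l) c.
  by case: (x); rewrite ?expr1 ?expr0 ?mulN1r ?mul1r.
by apply: cvgMl; apply: cvgD => //; exact: cvgMr.
Qed.


Let weighted_law k : {measure set (path_space R) -> \bar R} :=
  mscale (NngNum (jump_weight_ge0 k)) (jumps_law k).

(** The two measures agree on cylinders, a class that is stable under
    intersection and generates the sigma-algebra. *)
Lemma started_mixture (A : set (path_space R)) : measurable A ->
  (started P A = \sum_(k <oo) (jump_weight k)%:E * jumps_law k A)%E.
Proof.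
pose G : set (set (path_space R)) :=
  [set B | exists2 c, {in c, forall p, 0 <= p.1 <= 1} & B = cylinder c].
move=> mA; rewrite -[RHS]/(mseries weighted_law 0 A).
apply: (measure_unique G (fun=> setT)) => //.
- rewrite eqEsubset; split; apply: smallest_sub; try exact: smallest_sigma_algebra.
    move=> _ [t [x [t01 ->]]]; apply: sub_sigma_algebra; exists [:: (t, x)].
      by move=> p; rewrite inE => /eqP ->.
    by apply/seteqP; split=> X; rewrite /cylinder /state_at /= andbT => /eqP.
  move=> _ [c c01 ->]; exact: measurable_cylinder.
- move=> _ _ [c c01 ->] [c' c01' ->]; exists (c ++ c').
    by move=> p; rewrite mem_cat => /orP[/c01|/c01'].
  apply/seteqP; split=> X; rewrite /cylinder /= all_cat => /andP //.
- by move=> _; exists [::] => //; rewrite cylinder_nil.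
- by rewrite bigcup_const.
- move=> _ [c c01 ->]; have mc := measurable_cylinder c01.
  have nil01 : {in [::], forall t : R, 0 <= t <= 1} by [].
  transitivity (walsh (started P) [::] c)%:E.
    by rewrite walsh_nil fineK// fin_num_measure.
  rewrite -(eseries_EFin (walsh_series nil01 c01)); apply: eq_eseriesr => k _.
  by rewrite /= walsh_nil EFinM fineK// fin_num_measure.
- by move=> _; rewrite ltey_eq fin_num_measure.
Qed.

End mixture.

(** * The bridge as a mixture *)

Section bridge.
Context {R : realType}.
Implicit Types (X : cadlag R) (U : evenset R).

Definition walk_ends (k : nat) : set (cadlag R) :=
  state_at 0 false `&` state_at 1 (odd k).

Lemma measurable_walk_ends k : measurable (walk_ends k : set (path_space R)).
Proof. by apply: measurableI; apply: measurable_state_at; rewrite lexx ler01. Qed.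

(** Each flip preserves the state at time 0 and changes the state at time 1. *)
Lemma jumps_law_ends k : jumps_law k (~` walk_ends k) = 0%E :> \bar R.
Proof.
elim: k => [|k IH]; first by rewrite /= /dirac indicE memNset//= => -[].
have -> : jumps_law k.+1 (~` walk_ends k.+1) =
  (jumps_law k \x @unit_law R)%E (@flip_pair R @^-1` (~` walk_ends k.+1)) by [].
have -> : @flip_pair R @^-1` (~` walk_ends k.+1) = ~` walk_ends k `*` setT.
  apply/seteqP; split=> -[X r]; rewrite /flip_pair /walk_ends /state_at /=.
    move=> h; split=> // -[X0 X1]; apply: h.
    by split; rewrite -?[X 0 (+) _]/(flip r X 0) -?[X 1 (+) _]/(flip r X 1)
      ?flip0 ?flip1 ?X1.
  rewrite -?[X 0 (+) _]/(flip r X 0) -?[X 1 (+) _]/(flip r X 1) flip0 flip1.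
  by move=> [h _] [X0 X1]; apply: h; split=> //; rewrite -[X 1]negbK X1 negbK.
rewrite product_measure1E//; last first.
  by apply: measurableC; exact: measurable_walk_ends.
by rewrite [X in (X * _)%E](_ : _ = 0%E)// mul0e.
Qed.

Definition pin_path : path_space R -> evenset R := @pin R.

HB.instance Definition _ :=
  isMeasurableFun.Build _ _ _ _ pin_path (@measurable_pin R).

Definition pin_law k : probability (evenset R) R :=
  distribution (jumps_law k) pin_path.

Definition pin_mean (f : evenset R ->
  R) k : R := fine (\int[pin_law k]_U (f U)%:E)%E.

Lemma measurable_preimage_pin (A : set (evenset R)) : measurable A ->
  measurable (@pin R @^-1` A : set (path_space R)).
Proof. by move=> mA; rewrite -[X in measurable X]setTI; exact: measurable_pin. Qed.

(** Almost surely the path ends at 0 if and only if [k] is even. *)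
Lemma jumps_law_bridge k (A : set (evenset R)) : measurable A ->
  jumps_law k (@pin R @^-1` A `&` state_at 1 false) =
  if odd k then 0%E else pin_law k A.
Proof.
move=> mA; have m1 : measurable (state_at 1 false : set (path_space R)).
  by apply: measurable_state_at; rewrite lexx ler01.
have mpA := measurable_preimage_pin mA.
have mC : measurable (~` walk_ends k : set (path_space R)).
  by apply: measurableC; exact: measurable_walk_ends.
case: ifPn => [k_odd|k_even].
  apply: (@subset_measure0 _ _ _ (jumps_law k) _ (~` walk_ends k)) => //.
  - exact: measurableI.
  - by move=> X [_ X1] [_]; rewrite /state_at /= X1 k_odd.
  - exact: jumps_law_ends.
rewrite -[RHS]/(jumps_law k (@pin R @^-1` A)).
have null : jumps_law k (@pin R @^-1` A `\` state_at 1 false) = 0%E :> \bar R.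
  apply: (@subset_measure0 _ _ _ (jumps_law k) _ (~` walk_ends k)) => //.
  - exact: measurableD.
  - by move=> X [_ X1] [_]; rewrite /state_at /= (negbTE k_even).
  - exact: jumps_law_ends.
by rewrite (measureDI (jumps_law k) mpA m1) [X in (X + _)%E]null add0e.
Qed.

(** Both laws are images of one measure, the product of [jumps_law k] with the
    law of the next flip: [pin_law k] through the path before the flip, and
    [pin_law k.+1] through the path after it. *)
Lemma pin_law_step (f : evenset R -> R) k : measurable_fun setT f ->
  graph_lipschitz f -> (pin_law k).-integrable setT (EFin \o f) ->
  (pin_law k.+1).-integrable setT (EFin \o f) /\
  `|pin_mean f k.+1 - pin_mean f k| <= 2.
Proof.
move=> mf f_lip ik.
pose M : probability (path_space R * measurableTypeR R)%type R :=
  (jumps_law k \x @unit_law R)%E.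
pose pin0 : path_space R * measurableTypeR R -> evenset R := pin_path \o fst.
pose pin1 : path_space R * measurableTypeR R -> evenset R :=
  pin_path \o @flip_pair R.
have mpin0 : measurable_fun setT pin0.
  exact: measurableT_comp (@measurable_pin R) measurable_fst.
have mpin1 : measurable_fun setT pin1.
  exact: measurableT_comp (@measurable_pin R) (@measurable_flip_pair R).
have mEf : measurable_fun setT (EFin \o f) by exact/measurable_EFinP.
have law0 A : measurable A -> pin_law k A = pushforward M pin0 A.
  move=> mA; rewrite -[LHS]/(jumps_law k (@pin R @^-1` A)) /pushforward.
  have -> : pin0 @^-1` A = (@pin R @^-1` A) `*` setT.
    by apply/seteqP; split=> -[X r] //= [].
  rewrite /M /= product_measure1E//; last exact: measurable_preimage_pin.
  by rewrite [X in (_ * X)%E](probability_setT (@unit_law R)) mule1.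
have int0 (g : evenset R -> \bar R) :
    (\int[pin_law k]_U g U = \int[pushforward M pin0]_U g U)%E.
  by apply: eq_measure_integral => A mA _; exact: law0.
have i0 : M.-integrable setT (EFin \o (f \o pin0)).
  apply/integrableP; split.
    exact: (measurableT_comp mEf mpin0).
  have /integrableP[_] := ik; rewrite int0 ge0_integral_pushforward//.
  exact: measurableT_comp.
have [i1 le2] := integral_perturbation (measurableT_comp mf mpin0)
  (measurableT_comp mf mpin1) (fun p => lipschitz_pin p.2 p.1 f_lip) i0.
split; first exact: (integrable_pushforward mpin1 mEf i1 measurableT).
have E1 := integral_pushforward mpin1 mEf i1 measurableT.
have E0 := integral_pushforward mpin0 mEf i0 measurableT.
by rewrite /pin_mean int0 [in X in _ - X]E0 [in X in X - _]E1.
Qed.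

Lemma pin_law_integrable (f : evenset R -> R) k : measurable_fun setT f ->
  graph_lipschitz f -> (pin_law k).-integrable setT (EFin \o f).
Proof.
move=> mf f_lip; elim: k => [|k IH]; last by have [] := pin_law_step mf f_lip IH.
have mEf : measurable_fun setT (EFin \o f) by exact/measurable_EFinP.
have mfpin : measurable_fun setT (EFin \o (f \o pin_path)).
  exact: (measurableT_comp mEf (@measurable_pin R)).
apply: (integrable_pushforward (@measurable_pin R) mEf _ measurableT).
rewrite preimage_setT; apply/integrableP; split; first exact: mfpin.
rewrite integral_dirac//=; first by rewrite diracT mul1e ltry.
apply/measurable_EFinP; apply: measurableT_comp => //.
exact: measurableT_comp mf (@measurable_pin R).
Qed.

Section one_walk.
Variables (a : R) (P : probability (path_space R) R).
Hypotheses (a_ge0 : 0 <= a) (P_walk : random_walk_law a P)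
  (P_start : (0 < P (state_at 0 false))%E).

Let bridge_prob : R := fine (P (@bridge_paths R)).

Let even_weight k : R := if odd k then 0 else jump_weight a P k.

Let even_weight_ge0 k : 0 <= even_weight k.
Proof. by rewrite /even_weight; case: ifP => // _; exact: jump_weight_ge0. Qed.

Lemma bridge_paths_mixture (A : set (evenset R)) : measurable A ->
  (P (@bridge_paths R `&` @jump_set R @^-1` A) =
   \sum_(k <oo) (even_weight k)%:E * pin_law k A)%E.
Proof.
move=> mA; have m1 : measurable (state_at 1 false : set (path_space R)).
  by apply: measurable_state_at; rewrite lexx ler01.
have mpA := measurable_preimage_pin mA.
transitivity (started P (@pin R @^-1` A `&` state_at 1 false)).
  rewrite startedE; congr (P _); apply/seteqP; split=> X.
    by move=> [XB AX]; split; [split; [rewrite /= pin_bridge|case: XB]|case: XB].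
  by move=> [[AX X1] X0]; split => //=; rewrite -pin_bridge.
rewrite (started_mixture a_ge0 P_walk); last exact: measurableI.
apply: eq_eseriesr => k _; rewrite jumps_law_bridge// /even_weight.
by case: ifP; rewrite ?mule0 ?mul0e.
Qed.

(** The path without jumps already has positive probability. *)
Lemma bridge_prob_gt0 : 0 < bridge_prob.
Proof.
have E : (P (@bridge_paths R) = \sum_(k <oo) (even_weight k)%:E * pin_law k setT)%E.
  by rewrite -bridge_paths_mixture// preimage_setT setIT.
have PB : P (@bridge_paths R) \is a fin_num.
  by rewrite fin_num_measure//; exact: measurable_bridge_paths.
rewrite -lte_fin /bridge_prob fineK// E.
apply: lt_le_trans (nneseries_lim_ge 1 _); last first.
  by move=> k _ _; rewrite mule_ge0// lee_fin even_weight_ge0.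
rewrite big_nat1 [X in (_ * X)%E](probability_setT (pin_law 0)) mule1 lte_fin.
rewrite /even_weight /= /jump_weight expr0 fact0 divr1 mulr1 mulr_gt0 ?expR_gt0//.
by rewrite fine_gt0// P_start ltey_eq fin_num_measure//;
  apply: measurable_state_at; rewrite lexx ler01.
Qed.

Definition bridge_scale : R :=
  fine (P (state_at 0 false)) * expR (- a) / bridge_prob.

Lemma bridge_scale_ge0 : 0 <= bridge_scale.
Proof.
by rewrite divr_ge0 ?mulr_ge0 ?expR_ge0 ?fine_ge0.
Qed.

Lemma bridge_weight_ge0 k : 0 <= bridge_scale * (cosh_coeff k * a ^+ k).
Proof.
apply: mulr_ge0; first exact: bridge_scale_ge0.
by rewrite mulr_ge0 ?exprn_ge0//; exact: cosh_coeff_ge0.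
Qed.

(** The rate only enters the weights, not the laws [pin_law k]. *)
Lemma bridge_law_mixture (A : set (evenset R)) : measurable A ->
  (bridge_law P A = \sum_(k <oo) (bridge_scale * (cosh_coeff k * a ^+ k))%:E *
    pin_law k A)%E.
Proof.
move=> mA; rewrite /bridge_law bridge_paths_mixture// muleC -nneseriesZl//;
  last first.
  by move=> k _; rewrite mule_ge0// lee_fin even_weight_ge0.
apply: eq_eseriesr => k _; rewrite muleA -EFinM; congr (_%:E * _)%E.
rewrite /even_weight /cosh_coeff /bridge_scale /jump_weight.
by case: ifP => _; rewrite ?mul0r ?mulr0//; ring.
Qed.

Lemma bridge_mean_cvg (f : evenset R -> R) : measurable_fun setT f ->
  graph_lipschitz f -> (bridge_law P).-integrable setT (EFin \o f) ->
  (fun n => bridge_scale * weighted_sum cosh_coeff a (pin_mean f) n) @ \oo -->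
  fine (\int[bridge_law P]_U (f U)%:E)%E.
Proof.
move=> mf f_lip i_f.
have := integral_mixture_cvg bridge_weight_ge0 bridge_law_mixture i_f
  (fun k => pin_law_integrable k mf f_lip).
apply: cvg_trans; apply: near_eq_cvg; apply: nearW => n.
rewrite /series /= big_mkord /weighted_sum big_distrr /=.
by apply: eq_bigr => k _; exact/esym/mulrA.
Qed.

Lemma bridge_mass_cvg :
  (fun n => bridge_scale * weighted_sum cosh_coeff a (fun=> 1) n) @ \oo --> (1 : R).
Proof.
have mass : bridge_law P setT = 1%E.
  rewrite /bridge_law preimage_setT setIT -/bridge_prob.
  rewrite -[P _]fineK; last by rewrite fin_num_measure//;
    exact: measurable_bridge_paths.
  by rewrite -EFinM divff// gt_eqF// bridge_prob_gt0.
have : series (fun k => bridge_scale * (cosh_coeff k * a ^+ k)) @ \oo --> (1 : R).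
  apply: nneseries_EFin_cvg; first exact: bridge_weight_ge0.
  rewrite -mass bridge_law_mixture//; apply: eq_eseriesr => k _.
  by rewrite [X in (_ * X)%E](probability_setT (pin_law k)) mule1.
apply: cvg_trans; apply: near_eq_cvg; apply: nearW => n.
rewrite /series /= big_mkord /weighted_sum big_distrr /=.
by apply: eq_bigr => k _; rewrite mulr1.
Qed.

End one_walk.

End bridge.

Theorem proposition3p4 (R : realType) (alpha beta : R)
    (P Q : probability (path_space R) R)
    (alpha_ge0 : 0 <= alpha) (beta_ge0 : 0 <= beta)
    (P_walk : random_walk_law alpha P) (Q_walk : random_walk_law beta Q)
    (P_start : (0 < P (state_at 0 false))%E)
    (Q_start : (0 < Q (state_at 0 false))%E) :
  (dW1 (bridge_law P) (bridge_law Q) <=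
     (9 / 2 * `|alpha ^+ 2 - beta ^+ 2|)%:E)%E.
Proof.
apply: ge_ereal_sup => _ [f [[mf f_lip] iP iQ] <-].
have cvgP := bridge_mean_cvg alpha_ge0 P_walk mf f_lip iP.
have cvgQ := bridge_mean_cvg beta_ge0 Q_walk mf f_lip iQ.
have massP := bridge_mass_cvg alpha_ge0 P_walk P_start.
have massQ := bridge_mass_cvg beta_ge0 Q_walk Q_start.
rewrite -[X in (X - _)%E](fineK (integrable_fin_num measurableT iP)).
rewrite -[X in (_ - X)%E](fineK (integrable_fin_num measurableT iQ)).
rewrite -EFinB /= lee_fin.
apply: (@le_trans _ _ (2 * `|alpha ^+ 2 - beta ^+ 2|)); last first.
  by rewrite ler_wpM2r//; lra.
have lhs := cvg_norm (cvgB (cvgM cvgP massQ) (cvgM cvgQ massP)).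
have rhs := cvgM (cvg_cst (2 * `|alpha ^+ 2 - beta ^+ 2| : R)) (cvgM massP massQ).
rewrite !mulr1 in lhs rhs.
(* The normalized sums that converge to the total masses, both equal to 1, are
   inserted as factors: this cross-multiplied form is the one bounded by
   [cosh_sum_lipschitz]. *)
apply: (ler_cvg_to (lhs _ _ _ _) (rhs _ _ _)); apply: nearW => n /=.
have lip := cosh_sum_lipschitz n alpha_ge0 beta_ge0
  (fun k => (pin_law_step mf f_lip (pin_law_integrable k mf f_lip)).2).
have K0 := bridge_scale_ge0 alpha P; have L0 := bridge_scale_ge0 beta Q.
set K := bridge_scale alpha P in K0 *; set L := bridge_scale beta Q in L0 *.
have -> : forall A B C D : R, `|(K * A) * (L * B) - (L * C) * (K * D)| =
    K * L * `|A * B - C * D|.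
  by move=> A B C D; rewrite -(ger0_norm (mulr_ge0 K0 L0)) -normrM;
    congr Num.norm; ring.
apply: le_trans (ler_wpM2l (mulr_ge0 K0 L0) lip) _.
by rewrite le_eqVlt; apply/orP; left; apply/eqP; ring.
Qed.
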